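(* Let $k \geq 1$ be an integer. Then: (1) (Extremisers) For every compact abelian group $G$ and every $f \in L^\infty(G)$ with $\|f\|_{L^\infty(G)} \leq 1$, one has $\|f\|_{U^k(G)} = 1$ if and only if $f = e(P)$ almost everywhere for some polynomial $P: G \to \mathbf{R}/\mathbf{Z}$ of degree $\leq k-1$. (2) (Near-extremisers) There is a function $c_k:[0,\infty) \to [0,\infty)$, depending only on $k$, with $c_k(\varepsilon) \to 0$ as $\varepsilon \to 0$, such that the following holds: for every compact abelian group $G$, every $f \in L^\infty(G)$ with $\|f\|_{L^\infty(G)} \leq 1$ and every $\varepsilon \geq 0$, if $\|f\|_{U^k(G)} \geq 1-\varepsilon$ then there exists a polynomial $P: G \to \mathbf{R}/\mathbf{Z}$ of degree $\leq k-1$ such that $\|f-e(P)\|_{L^1(G)} \leq c_k(\varepsilon)$.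
   Context: All locally compact abelian groups are assumed second countable. A compact abelian group $G$ is equipped with its normalised Haar probability measure $\mu$, and $L^p(G)$ norms are taken with respect to $\mu$. For $h \in G$, $T^h f(x) := f(x-h)$. The Gowers norm is defined recursively by $\|f\|_{U^1(G)} := |\int_G f\,d\mu|$ and $\|f\|_{U^{k+1}(G)} := \left(\int_G \|(T^h f)\overline{f}\|_{U^k(G)}^{2^k}\,d\mu(h)\right)^{1/2^{k+1}}$; equivalently $\|f\|_{U^k(G)}^{2^k} = \int_{G^{k+1}} \prod_{\omega \in \{0,1\}^k} \mathcal{C}^{|\omega|} f(x+\omega_1 h_1+\dots+\omega_k h_k)\,d\mu(x)d\mu(h_1)\cdots d\mu(h_k)$, where $\mathcal{C}$ is complex conjugation and $|\omega| = \omega_1+\dots+\omega_k$. A measurable map $P: G \to \mathbf{R}/\mathbf{Z}$ is a polynomial of degree $\leq d$ if $\Delta_{h_1}\cdots\Delta_{h_{d+1}} P(x) = 0$ for almost every $x,h_1,\dots,h_{d+1} \in G$, where $\Delta_h P(x) := P(x-h)-P(x)$. $e(x) := e^{2\pi i x}$. *)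

(* Defs.v *)
From HB Require Import structures.
From mathcomp Require Import all_boot all_order all_algebra.
From mathcomp Require Import all_classical all_reals all_analysis.
From mathcomp Require Import complex.

Set Implicit Arguments.
Unset Strict Implicit.
Unset Printing Implicit Defensive.

Import Order.TTheory GRing.Theory Num.Theory.
Local Open Scope classical_set_scope.
Local Open Scope ring_scope.

Definition borel (G : topologicalZmodType) : Type := G.
Section BorelInstance.
Variable G : topologicalZmodType.
HB.instance Definition _ := Choice.on (borel G).
HB.instance Definition _ := isPointed.Build (borel G) (0 : G).
Lemma borel_sigma_algebraC (A : set (borel G)) :
  <<s @open G >> A -> <<s @open G >> (~` A).
Proof. by move=> sGA; rewrite -setTD; exact: sigma_algebraCD. Qed.
HB.instance Definition _ := @isMeasurable.Build (sigma_display (@open G))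
  (borel G) <<s @open G >> (@sigma_algebra0 _ setT (@open G))
  (@borel_sigma_algebraC) (@sigma_algebra_bigcup _ setT (@open G)).
End BorelInstance.


Section Defs.
Context {R : realType} {G : topologicalZmodType}.

Definition compact_abelian_group : Prop :=
  [/\ hausdorff_space G, compact [set: G] & @second_countable G].

Definition normalised_haar (mu : probability (borel G) R) : Prop :=
  forall (A : set G) (h : G), measurable (A : set (borel G)) ->
    mu [set x + h | x in A] = mu A.

Variable mu : probability (borel G) R.

Definition cmeasurable (f : G -> R[i]) : Prop :=
  measurable_fun [set: borel G] (fun x => complex.Re (f x)) /\
  measurable_fun [set: borel G] (fun x => complex.Im (f x)).

Definition Linf_le1 (f : G -> R[i]) : Prop :=
  {ae mu, forall x, complex.ComplexField.Normc.normc (f x) <= 1}.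

Definition cintegral (f : G -> R[i]) : R[i] :=
  complex.Complex (Rintegral mu [set: borel G] (fun x => complex.Re (f x)))
                  (Rintegral mu [set: borel G] (fun x => complex.Im (f x))).

Definition transl (h : G) (f : G -> R[i]) : G -> R[i] := fun x => f (x - h).

(* gowers_rec k f = ||f||_{U^(k+1)(G)}, following the recursive definition
   ||f||_{U^1} = |int f|,
   ||f||_{U^(k+1)} = (int ||T^h f * conj f||_{U^k}^(2^k) dmu(h))^(1/2^(k+1)). *)
Fixpoint gowers_rec (k : nat) (f : G -> R[i]) : R :=
  match k with
  | 0 => complex.ComplexField.Normc.normc (cintegral f)
  | k'.+1 =>
      (fine (\int[mu]_h
         (((gowers_rec k' (fun x => transl h f x * complex.conjc (f x)))
            ^+ (2 ^ k'.+1))%:E)%E))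
        `^ ((2 ^ k'.+2)%:R)^-1
  end.

Definition gowers_norm (k : nat) (f : G -> R[i]) : R := gowers_rec k.-1 f.

(* "Q holds for mu^n-almost every (h_1, ..., h_n)" *)
Fixpoint ae_n (n : nat) (Q : seq G -> Prop) : Prop :=
  match n with
  | 0 => Q [::]
  | n'.+1 => {ae mu, forall h, ae_n n' (fun s => Q (h :: s))}
  end.

Definition diff_iter (hs : seq G) (P : G -> R) : G -> R :=
  foldr (fun h Q x => Q (x - h) - Q x) P hs.

(* A measurable map P : G -> R/Z, represented by a measurable real lift
   P : G -> R, is a polynomial of degree <= deg if
   Delta_{h_1} ... Delta_{h_(deg+1)} P (x) = 0 in R/Z for almost every
   x, h_1, ..., h_(deg+1). *)
Definition polynomial_le (deg : nat) (P : G -> R) : Prop :=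
  measurable_fun [set: borel G] P /\
  {ae mu, forall x, ae_n deg.+1
      (fun hs => exists z : int, diff_iter hs P x = z%:~R)}.

End Defs.

Definition e_ {R : realType} (x : R) : R[i] :=
  complex.Complex (cos (2 * pi * x)) (sin (2 * pi * x)).

(* Main.v *)
(* Write [osc t = 1 - cos (2 pi t)], half of [|1 - e(t)|^2]; it satisfies
   [osc (s + t) <= 2 osc s + 2 osc t], so all estimates are linear in the
   defect [eps] and no measurable selection is needed.
   - In polar form [f = a e(p)] the U^n norm close to 1 says that
     [osc (D_h1 .. D_hn p)] is small on average.  The cocycle identity
     [D_h p = D_s p + (D_(h-s) p)(. - s)], averaged over [s], upgrades this to:
     for every [h1, .., hn] it is small on average over [x] ([smooth]).
   - Majority vote: [g_(n+1) p x] is the centre of mass direction, over [s], of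
     [e (p (x - s) - g_n (D_s p) x)].  By induction [g_n] is close to [p] in
     mean, almost additive in [p] at every point, and
     [D_h (g_(n+1) p)] is uniformly close to [g_n (D_h p)], so that
     [D_h1 .. D_hn (g_n p)] is uniformly close to 0 modulo 1.
   - Correction: the small real representatives [c] of [D_h1 .. D_hn (g_n p)],
     averaged over [h1, .., hn], give up to sign a small real function [r] with
     [D_h1 .. D_hn r = c] exactly, so [g_n p - r] is an exact polynomial.
   This yields [|| f - e(P) ||_2 ^ 2 <= K_n eps] for all [eps >= 0], from which
   both parts follow; for the converse in (1) the average of [osc] vanishes. *)
Require Import Defs.
From HB Require Import structures.
From mathcomp Require Import all_boot all_order all_algebra.
From mathcomp Require Import all_classical all_reals all_analysis.
From mathcomp Require Import complex measurable_realfun ring lra.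
Set Implicit Arguments.
Unset Strict Implicit.
Unset Printing Implicit Defensive.

Import Order.TTheory GRing.Theory Num.Theory.
Import numFieldTopology.Exports numFieldNormedType.Exports.
Local Open Scope classical_set_scope.
Local Open Scope ring_scope.

(** * Trigonometry in turns: the functions [osc] and [cent], and the argument of a plane vector *)

Section Trigonometry.
Context {R : realType}.
Implicit Types s t x y : R.

Definition cosc t : R := cos (2 * pi * t).
Definition sinc t : R := sin (2 * pi * t).
Definition osc t : R := 1 - cosc t.

Lemma cosc_sinc_sqr t : cosc t ^+ 2 + sinc t ^+ 2 = 1.
Proof. exact: cos2Dsin2. Qed.

Lemma coscD s t : cosc (s + t) = cosc s * cosc t - sinc s * sinc t.
Proof. by rewrite /cosc mulrDr cosD. Qed.

Lemma coscN t : cosc (- t) = cosc t.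
Proof. by rewrite /cosc mulrN cosN. Qed.

Lemma sincN t : sinc (- t) = - sinc t.
Proof. by rewrite /sinc mulrN sinN. Qed.

Lemma coscB s t : cosc (s - t) = cosc s * cosc t + sinc s * sinc t.
Proof. by rewrite coscD coscN sincN mulrN opprK. Qed.

Lemma sincB s t : sinc (s - t) = sinc s * cosc t - cosc s * sinc t.
Proof. by rewrite /sinc /cosc mulrBr sinB. Qed.

Lemma cosc_nat (n : nat) : cosc n%:R = 1.
Proof.
rewrite /cosc; elim: n => [|n IH]; first by rewrite mulr0 cos0.
rewrite -[n.+1%:R]natr1 mulrDr mulr1 [X in _ + X]mulr_natl cosD2pi.
exact: IH.
Qed.

Lemma cosc_int (n : int) : cosc n%:~R = 1.
Proof.
case: n => n; first exact: cosc_nat.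
by rewrite NegzE mulrNz coscN cosc_nat.
Qed.

Lemma osc_int (n : int) : osc n%:~R = 0.
Proof. by rewrite /osc cosc_int subrr. Qed.

Lemma osc0 : osc 0 = 0.
Proof. exact: (osc_int 0). Qed.

Lemma oscN t : osc (- t) = osc t.
Proof. by rewrite /osc coscN. Qed.

Lemma osc_ge0 t : 0 <= osc t.
Proof. by rewrite subr_ge0 cos_le1. Qed.

Lemma osc_le2 t : osc t <= 2.
Proof. by have := cos_geN1 (2 * pi * t); rewrite /osc /cosc; lra. Qed.

(* Expand [0 <= |e(s) + e(-t) - 2|^2]. *)
Lemma oscD s t : osc (s + t) <= 2 * osc s + 2 * osc t.
Proof.
rewrite /osc coscD; have := cosc_sinc_sqr s; have := cosc_sinc_sqr t.
have := sqr_ge0 (cosc s + cosc t - 2); have := sqr_ge0 (sinc s - sinc t).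
move: (cosc s) (sinc s) (cosc t) (sinc t) => a b c d; nra.
Qed.

Lemma oscB s t : osc (s - t) <= 2 * osc s + 2 * osc t.
Proof. by rewrite -(oscN t) oscD. Qed.

Lemma oscD_int t (n : int) : osc (t + n%:~R) = osc t.
Proof.
rewrite /osc coscD cosc_int.
suff -> : sinc n%:~R = 0 by rewrite mulr1 mulr0 subr0.
have := cosc_sinc_sqr (n%:~R : R); rewrite cosc_int.
by move/eqP; rewrite -subr_eq0 expr1n addrAC subrr add0r sqrf_eq0 => /eqP.
Qed.

(** The representative of [t] modulo 1 in [-1/2, 1/2). It turns smallness modulo 1 into smallness of
    a real number, which can be averaged. *)
Definition cent t : R := t - (Num.floor (t + 2^-1))%:~R.

Lemma cent_ge t : - 2^-1 <= cent t.
Proof. by rewrite /cent; have := ge_floor (t + 2^-1); lra. Qed.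

Lemma cent_lt t : cent t < 2^-1.
Proof. by rewrite /cent; have := floorD1_gt (t + 2^-1); rewrite intrD; lra. Qed.

Lemma osc_cent t : osc (cent t) = osc t.
Proof. by rewrite /cent -mulrNz oscD_int. Qed.

Lemma centE t : exists n : int, cent t = t + n%:~R.
Proof. by exists (- Num.floor (t + 2^-1)); rewrite mulrNz. Qed.


Lemma osc_norm t : osc `|t| = osc t.
Proof. by case: (ger0P t) => // _; rewrite oscN. Qed.

(** Cosine is strictly decreasing on [0, pi], the range of 2 pi |t| for |t| at most 1/2. *)
Lemma osc_lt_norm s t : `|s| <= 2^-1 -> `|t| <= 2^-1 ->
  (osc s < osc t) = (`|s| < `|t|).
Proof.
move=> hs ht; have P := pi_gt0 R.
have in0pi x : `|x| <= 2^-1 -> 2 * pi * `|x| \in `[0, pi].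
  move=> hx; rewrite in_itv /= !mulr_ge0 ?pi_ge0 //=.
  rewrite [X in _ <= X](_ : pi = 2 * pi * 2^-1); last first.
    by rewrite mulrAC mulfV ?mul1r ?pnatr_eq0.
  by rewrite ler_wpM2l // mulr_ge0 ?pi_ge0.
rewrite -osc_norm -(osc_norm t) /osc /cosc ltrD2l ltrN2 ltr_cos ?in0pi //.
by rewrite ltr_pM2l // mulr_gt0.
Qed.

Lemma osc_le_norm s t : `|s| <= 2^-1 -> `|t| <= 2^-1 ->
  (osc s <= osc t) = (`|s| <= `|t|).
Proof. by move=> hs ht; rewrite !leNgt osc_lt_norm. Qed.

Lemma cent_norm t : `|cent t| <= 2^-1.
Proof. by rewrite ler_norml cent_ge ltW // cent_lt. Qed.

Lemma osc_quarter : osc 4^-1 = 1.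
Proof.
rewrite /osc /cosc (_ : 2 * pi * 4^-1 = pi / 2) ?cos_pihalf ?subr0 //.
by field.
Qed.

(** The threshold 1 for [osc] is a quarter turn. Three such representatives add up to less than 1 in
    absolute value, which is what makes [cent] additive in [centB_small]. *)
Lemma cent_quarter t : osc t <= 1 -> `|cent t| <= 4^-1.
Proof.
have q0 : `|4^-1| = 4^-1 :> R by rewrite gtr0_norm.
rewrite -osc_cent -[X in _ <= X -> _]osc_quarter osc_le_norm ?cent_norm // q0 //.
lra.
Qed.

(** Together with [osc_le_norm] this converts a bound on [osc] into a bound on absolute values,
    which survives averaging. *)
Lemma osc_preimage d : 0 <= d -> d <= 1 ->
  exists r, [/\ 0 <= r, r <= 2^-1 & osc r = d].
Proof.
move=> d0 d1; have P := pi_gt0 R; exists (acos (1 - d) / (2 * pi)).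
have hd : -1 <= 1 - d <= 1 by apply/andP; split; lra.
split.
- by rewrite divr_ge0 ?acos_ge0 // mulr_ge0 ?pi_ge0.
- rewrite ler_pdivrMr ?mulr_gt0 // mulrA mulVf ?mul1r ?pnatr_eq0 //.
  exact: acos_lepi.
rewrite /osc /cosc mulrC divfK; last by rewrite gt_eqF ?mulr_gt0.
by rewrite acosK ?in_itv //; lra.
Qed.

Lemma int_small (n : int) : `|n%:~R : R| < 1 -> n = 0.
Proof. by rewrite -intr_norm -[1]/(1%:~R) ltr_int; case: n => [[|n]|n]. Qed.

(** The preimage of a ray under a monotone map is an interval. This serves for the floor in
    [cent]. *)
Lemma nondecreasing_measurable (f : R -> R) :
  {homo f : x y / x <= y} -> measurable_fun setT f.
Proof.
move=> hf; apply: (measurability _ (RGenOInfty.measurableE R)).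
move=> _ [_ [a ->] <-]; rewrite setTI; apply: is_interval_measurable.
move=> x y /=; rewrite !in_itv /= !andbT => fx _ z /andP[xz _].
by rewrite in_itv /= andbT (lt_le_trans fx) // hf.
Qed.

Lemma measurable_cent : measurable_fun setT cent.
Proof.
apply: measurable_funB => //; apply: nondecreasing_measurable => x y xy.
by rewrite ler_int le_floor // lerD2r.
Qed.

Lemma measurable_cosc : measurable_fun setT cosc.
Proof.
apply: continuous_measurable_fun => x; apply: continuous_comp.
  exact: mulrl_continuous.
exact: continuous_cos.
Qed.

Lemma measurable_sinc : measurable_fun setT sinc.
Proof.
apply: continuous_measurable_fun => x; apply: continuous_comp.
  exact: mulrl_continuous.
exact: continuous_sin.
Qed.

Lemma measurable_osc : measurable_fun setT osc.
Proof. by apply: measurable_funB => //; exact: measurable_cosc. Qed.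

Lemma measurable_inv : measurable_fun setT (@GRing.inv R).
Proof.
rewrite -(setUv [set (0 : R)]); apply/measurable_funU => //.
  exact: measurableC.
split; first exact: measurable_fun_set1.
apply: open_continuous_measurable_fun.
  apply: closed_openC; apply: accessible_closed_set1.
  exact: hausdorff_accessible (@Rhausdorff R).
by move=> x; rewrite inE /= => /eqP x0; exact: inv_continuous.
Qed.

(* The argument of [a + ib] in turns: [2 atan (b / (r + a))] off the negative axis. *)
Definition arg (a b : R) : R :=
  let r := Num.sqrt (a ^+ 2 + b ^+ 2) in
  if r + a == 0 then 2^-1 else atan (b * (r + a)^-1) / pi.

Lemma argP a b (r := Num.sqrt (a ^+ 2 + b ^+ 2)) :
  a = r * cosc (arg a b) /\ b = r * sinc (arg a b).
Proof.
have P : pi != 0 :> R by rewrite gt_eqF ?pi_gt0.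
have r2 : r ^+ 2 = a ^+ 2 + b ^+ 2 by rewrite sqr_sqrtr ?addr_ge0 ?sqr_ge0.
have r0 : 0 <= r by exact: sqrtr_ge0.
(* If r + a = 0 then b = 0 and a = - r, so half a turn is a correct angle; the origin is
   included. *)
rewrite /arg -/r /cosc /sinc; case: eqP => [ra|/eqP ra].
  have b0 : b = 0.
    by apply/eqP; rewrite -sqrf_eq0; apply/eqP; nra.
  by rewrite mulrAC mulfV ?pnatr_eq0 // mul1r cospi sinpi b0; split; lra.
(* Half-angle substitution: y is the tangent of half the angle, whose squared cosine 1 / (1 + y^2)
   simplifies to (r + a) / (2 r). The double angle formulas then give a / r and b / r. *)
set y := b * (r + a)^-1.
have -> : 2 * pi * (atan y / pi) = atan y *+ 2.
  by rewrite mulrCA -mulrA divff // mulr1 mulr_natr.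
rewrite cos_mulr2n sin_mulr2n.
have c2 : cos (atan y) ^+ 2 = (1 + y ^+ 2)^-1.
  by rewrite cos_atan exprVn sqr_sqrtr // addr_ge0 ?sqr_ge0.
have c0 : cos (atan y) != 0.
  by rewrite cos_atan invr_eq0 sqrtr_eq0 -ltNge ltr_pwDl ?sqr_ge0.
have sE : sin (atan y) = y * cos (atan y).
  by rewrite -{2}[y]atanK /tan divfK.
have rn : r != 0.
  apply: contra_neq ra => rE; move: r2; rewrite rE expr0n /=.
  have := sqr_ge0 a; have := sqr_ge0 b => ? ? ?.
  have : a ^+ 2 == 0 by apply/eqP; lra.
  by rewrite sqrf_eq0 add0r => /eqP.
have yE : 1 + y ^+ 2 = 2 * r / (r + a).
  have bE : b ^+ 2 = r ^+ 2 - a ^+ 2 by rewrite r2 addrAC subrr add0r.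
  by rewrite /y exprMn bE; field.
have cE : cos (atan y) ^+ 2 = (r + a) / (2 * r) by rewrite c2 yE invf_div.
have -> : cos (atan y) * sin (atan y) = y * cos (atan y) ^+ 2.
  by rewrite sE expr2 mulrCA.
rewrite cE /y -mulr_natr -(mulr_natr _ 2).
by split; field; rewrite ?rn ?ra.
Qed.

Lemma measurable_arg d (T : measurableType d) (u v : T -> R) :
  measurable_fun setT u -> measurable_fun setT v ->
  measurable_fun setT (fun z => arg (u z) (v z)).
Proof.
move=> mu mv; rewrite /arg.
have mr : measurable_fun setT (fun z => Num.sqrt (u z ^+ 2 + v z ^+ 2) + u z).
  apply: measurable_funD => //; apply: (measurableT_comp (f := @Num.sqrt R)).
    by apply: continuous_measurable_fun; exact: sqrt_continuous.
  by apply: measurable_funD; exact: measurable_funX.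
apply: measurable_fun_ifT => //.
  by apply: (measurable_fun_eqr mr); exact: measurable_cst.
apply: measurable_funM => //; apply: (measurableT_comp (f := @atan R)).
  by apply: continuous_measurable_fun; exact: continuous_atan.
apply: measurable_funM => //.
exact: (measurableT_comp measurable_inv).
Qed.

End Trigonometry.

(** * Bounded measurable functions *)

Section BoundedMeasurable.
Context {R : realType} {d : measure_display} {T : measurableType d}.
Implicit Types u v : T -> R.

(** The bound holds at every point, so these functions are integrable for every probability measure
    and stable under products and partial averages; one predicate covers every integrability
    condition below. *)
Definition bmeas u := measurable_fun setT u /\ exists M, forall x, `|u x| <= M.

Lemma bmeas_cst c : bmeas (fun=> c).
Proof. by split; [exact: measurable_cst|exists `|c|]. Qed.

Lemma bmeasD u v : bmeas u -> bmeas v -> bmeas (fun x => u x + v x).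
Proof.
move=> [mu [M hM]] [mv [N hN]]; split; first exact: measurable_funD.
by exists (M + N) => x; rewrite (le_trans (ler_normD _ _)) ?lerD.
Qed.

Lemma bmeasM u v : bmeas u -> bmeas v -> bmeas (fun x => u x * v x).
Proof.
move=> [mu [M hM]] [mv [N hN]]; split; first exact: measurable_funM.
by exists (M * N) => x; rewrite normrM ler_pM.
Qed.

Lemma bmeasN u : bmeas u -> bmeas (fun x => - u x).
Proof.
move=> [mu [M hM]]; split; first exact: measurable_funN.
by exists M => x; rewrite normrN.
Qed.

Lemma bmeasB u v : bmeas u -> bmeas v -> bmeas (fun x => u x - v x).
Proof. by move=> bu bv; apply: bmeasD => //; exact: bmeasN. Qed.

Lemma bmeas_comp (b : R -> R) M u : measurable_fun setT b ->
  (forall t, `|b t| <= M) -> measurable_fun setT u -> bmeas (fun x => b (u x)).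
Proof.
move=> mb hb mu; split; first exact: measurableT_comp.
by exists M => x.
Qed.

Lemma bmeas_osc u : measurable_fun setT u -> bmeas (fun x => osc (u x)).
Proof.
move=> mu; apply: (bmeas_comp (M := 2)) => //; first exact: measurable_osc.
by move=> t; rewrite ger0_norm ?osc_ge0 ?osc_le2.
Qed.

Lemma bmeas_cosc u : measurable_fun setT u -> bmeas (fun x => cosc (u x)).
Proof.
move=> mu; apply: (bmeas_comp (M := 1)) => //; first exact: measurable_cosc.
by move=> t; exact: cos_max.
Qed.

Lemma bmeas_sinc u : measurable_fun setT u -> bmeas (fun x => sinc (u x)).
Proof.
move=> mu; apply: (bmeas_comp (M := 1)) => //; first exact: measurable_sinc.
by move=> t; exact: sin_max.
Qed.

Lemma bmeas_cent u : measurable_fun setT u -> bmeas (fun x => cent (u x)).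
Proof.
move=> mu; apply: (bmeas_comp (M := 2^-1)) => //; first exact: measurable_cent.
exact: cent_norm.
Qed.

End BoundedMeasurable.

Lemma bmeasT_comp {R : realType} {d1 d2} {T1 : measurableType d1}
    {T2 : measurableType d2} (u : T2 -> R) (g : T1 -> T2) :
  bmeas u -> measurable_fun setT g -> bmeas (fun x => u (g x)).
Proof.
by move=> [mu [M hM]] mg; split; [exact: measurableT_comp|exists M => x].
Qed.

(** * Averages over a probability space *)

Section Mean.
Context {R : realType} {d : measure_display} {T : measurableType d}.
Context (P : probability T R).
Implicit Types u v : T -> R.

Definition mean u : R := Rintegral P setT u.

Lemma bmeas_integrable u : bmeas u -> P.-integrable setT (EFin \o u).
Proof.
move=> [mu [M hM]]; apply: measurable_bounded_integrable => //.
  by apply: (le_lt_trans (probability_le1 P measurableT)); rewrite ltry.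
exists M; split; first by rewrite num_real.
by move=> y My x _; exact: le_trans (hM x) (ltW My).
Qed.

Lemma EFin_mean u : bmeas u -> (mean u)%:E = (\int[P]_x (u x)%:E)%E.
Proof.
by move=> bu; rewrite /mean /Rintegral fineK // integrable_fin_num //;
  exact: bmeas_integrable.
Qed.

Lemma eq_mean u v : u =1 v -> mean u = mean v.
Proof. by move/funext => ->. Qed.

Lemma le_mean u v : bmeas u -> bmeas v -> (forall x, u x <= v x) ->
  mean u <= mean v.
Proof. by move=> bu bv uv; apply: le_Rintegral => //; exact: bmeas_integrable. Qed.

Lemma mean_cst c : mean (fun=> c) = c.
Proof.
rewrite /mean Rintegral_cst // -[RHS]mulr1; congr (_ * _).
exact: (congr1 fine (probability_setT P)).
Qed.

Lemma meanD u v : bmeas u -> bmeas v ->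
  mean (fun x => u x + v x) = mean u + mean v.
Proof. by move=> bu bv; apply: RintegralD => //; exact: bmeas_integrable. Qed.

Lemma meanB u v : bmeas u -> bmeas v ->
  mean (fun x => u x - v x) = mean u - mean v.
Proof. by move=> bu bv; apply: RintegralB => //; exact: bmeas_integrable. Qed.

Lemma meanZ c u : bmeas u -> mean (fun x => c * u x) = c * mean u.
Proof. by move=> bu; apply: RintegralZl => //; exact: bmeas_integrable. Qed.

Lemma mean_ge0 u : (forall x, 0 <= u x) -> 0 <= mean u.
Proof. by move=> u0; apply: Rintegral_ge0. Qed.

Lemma mean_le_cst u c : bmeas u -> (forall x, u x <= c) -> mean u <= c.
Proof.
by move=> bu uc; rewrite -(mean_cst c); apply: le_mean => //; exact: bmeas_cst.
Qed.

Lemma mean_ge_cst u c : bmeas u -> (forall x, c <= u x) -> c <= mean u.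
Proof.
by move=> bu uc; rewrite -(mean_cst c); apply: le_mean => //; exact: bmeas_cst.
Qed.

Lemma mean_norm_le u c : bmeas u -> (forall x, `|u x| <= c) -> `|mean u| <= c.
Proof.
move=> bu uc; rewrite ler_norml; apply/andP; split.
  by apply: mean_ge_cst => // x; have := uc x; rewrite ler_norml => /andP[].
by apply: mean_le_cst => // x; have := uc x; rewrite ler_norml => /andP[].
Qed.

Lemma eq_mean_ae u v : measurable_fun setT u -> measurable_fun setT v ->
  {ae P, forall x, u x = v x} -> mean u = mean v.
Proof.
move=> mu mv uv; rewrite /mean /Rintegral; congr fine.
apply: ae_eq_integral => //; try exact/measurable_EFinP.
by apply: filterS uv => x /= ->.
Qed.

Lemma mean_eq0_ae u : measurable_fun setT u -> (forall x, 0 <= u x) ->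
  {ae P, forall x, u x = 0} -> mean u = 0.
Proof.
move=> mu u0 h; by rewrite (@eq_mean_ae u (cst 0)) ?mean_cst.
Qed.

Lemma ae_of_mean_eq0 u : bmeas u -> (forall x, 0 <= u x) ->
  mean u = 0 -> {ae P, forall x, u x = 0}.
Proof.
move=> bu u0 h.
have /ae_eq_integral_abs : (\int[P]_(x in setT) `|(u x)%:E| = 0)%E.
  under eq_integral => x _ do rewrite /= ger0_norm //.
  by rewrite -EFin_mean // h.
move=> H; have mu : measurable_fun setT (EFin \o u).
  by apply/measurable_EFinP; case: bu.
by apply: filterS (H measurableT mu) => x /= /(_ I)[].
Qed.

Lemma ae_imp (A B : T -> Prop) : (forall x, A x -> B x) ->
  {ae P, forall x, A x} -> {ae P, forall x, B x}.
Proof. by move=> AB; apply: filterS. Qed.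

Lemma ae_imp2 (A B C : T -> Prop) : (forall x, A x -> B x -> C x) ->
  {ae P, forall x, A x} -> {ae P, forall x, B x} -> {ae P, forall x, C x}.
Proof. by move=> ABC; apply: filterS2. Qed.

Lemma bmeas_mean {d'} {S : measurableType d'} (U : S * T -> R) :
  bmeas U -> bmeas (fun s => mean (fun x => U (s, x))).
Proof.
move=> [mU [M hM]]; split; last first.
  exists M => s; apply: mean_norm_le => // .
  by apply: bmeasT_comp; [split; [|exists M]|exact: pair1_measurable].
have bs s : bmeas (fun x => U (s, x)).
  by apply: bmeasT_comp; [split; [|exists M]|exact: pair1_measurable].
(* Measurability of partial integrals comes from Tonelli, which asks for a nonnegative integrand;
   adding the bound [M] provides one. *)
have -> : (fun s => mean (fun x => U (s, x))) =
    (fun s => fine (\int[P]_x (U (s, x) + M)%:E) - M).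
  apply/funext => s; rewrite -EFin_mean /=; last by apply: bmeasD => //; exact: bmeas_cst.
  by rewrite meanD ?mean_cst ?addrK //; exact: bmeas_cst.
apply: measurable_funB => //.
apply: (measurableT_comp (f := fine)); first exact: fine_measurable.
apply: (@measurable_fun_fubini_tonelli_F _ _ _ _ _ P (fun z => (U z + M)%:E)).
  by apply/measurable_EFinP; exact: measurable_funD.
move=> z; rewrite lee_fin; have := hM z; rewrite ler_norml => /andP[]; lra.
Qed.

End Mean.

Lemma mean_swap {R : realType} {d1 d2} {T1 : measurableType d1}
    {T2 : measurableType d2} (P1 : probability T1 R) (P2 : probability T2 R)
    (U : T1 * T2 -> R) : bmeas U ->
  mean P1 (fun x => mean P2 (fun y => U (x, y))) =
  mean P2 (fun y => mean P1 (fun x => U (x, y))).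
Proof.
move=> bU; apply/EFin_inj; rewrite !EFin_mean; last 2 first.
- apply: (bmeas_mean P1 (U := fun z => U (z.2, z.1))).
  by apply: bmeasT_comp => //; exact: measurable_swap.
- exact: (bmeas_mean P2 bU).
under eq_integral => x _.
  rewrite EFin_mean; last by apply: bmeasT_comp => //; exact: pair1_measurable.
  over.
under [RHS]eq_integral => y _.
  rewrite EFin_mean; last by apply: bmeasT_comp => //; exact: pair2_measurable.
  over.
apply: (Fubini (m1 := P1) (m2 := P2) (f := EFin \o U)).
exact: (bmeas_integrable (P1 \x P2)%E).
Qed.

(** * Borel measurability of subtraction on a second countable group *)

Section BorelGroup.
Context {G : topologicalZmodType}.

(** An open set is the union of the basic open rectangles that it contains, and second countability
    leaves only countably many of them. Hence Borel sets of the product belong to the product of the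
    Borel sigma-algebras. *)
Lemma open_measurable_prod (W : set (G * G)) : @second_countable G -> open W ->
  measurable (W : set (borel G * borel G)).
Proof.
move=> [B cB [oB bB]] oW.
pose D := [set p | (B `*` B) p /\ p.1 `*` p.2 `<=` W].
have -> : W = \bigcup_(p in D) (p.1 `*` p.2).
  rewrite eqEsubset; split; last by move=> z [p [_ pW]] /pW.
  move=> [x y] Wxy; have : nbhs (x, y) W by exact: open_nbhs_nbhs.
  move=> [[U V] /= [nU nV] UVW].
  have [U' [/= BU' U'x] U'U] := bB x U nU.
  have [V' [/= BV' V'y] V'V] := bB y V nV.
  exists (U', V') => //; split => // -[a b] /= [/U'U ? /V'V ?]; exact: UVW.
rewrite bigcup_set_type; apply: countable_bigcupT_measurable.
  rewrite (eq_countable (card_setT D)).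
  by apply: sub_countable (countableX cB cB); apply: subset_card_le => p [].
move=> [[U V] /= /set_mem[/= [BU BV] _]].
by apply: measurableX; apply: sub_sigma_algebra; exact: oB.
Qed.

Lemma measurable_subG_prod : @second_countable G ->
  measurable_fun setT (fun z : borel G * borel G => (z.1 : G) - z.2 : borel G).
Proof.
move=> scG; apply: (@measurability _ _ _ (borel G) setT _ (@open G)) => //.
move=> _ [U oU <-]; rewrite setTI.
apply: (open_measurable_prod (W := (fun z : G * G => z.1 - z.2) @^-1` U)) => //.
by move/continuousP : (@sub_continuous G); exact.
Qed.

End BorelGroup.

(** * Invariance of Haar averages under translation and reflection *)

Section HaarGroup.
Context {R : realType} {G : topologicalZmodType} (mu : probability (borel G) R).

Definition haar_group := @second_countable G /\ normalised_haar mu.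

Hypothesis H : haar_group.

Lemma measurable_subG d (T : measurableType d) (u v : T -> borel G) :
  measurable_fun setT u -> measurable_fun setT v ->
  measurable_fun setT (fun t => (u t : G) - v t : borel G).
Proof.
move=> mu' mv.
exact: (measurableT_comp (measurable_subG_prod H.1) (measurable_fun_pair mu' mv)).
Qed.

Lemma measurable_addG d (T : measurableType d) (u v : T -> borel G) :
  measurable_fun setT u -> measurable_fun setT v ->
  measurable_fun setT (fun t => (u t : G) + v t : borel G).
Proof.
move=> mu' mv.
have -> : (fun t => (u t : G) + v t) = (fun t => (u t : G) - ((0 : G) - v t)).
  by apply/funext => t; rewrite sub0r opprK.
by apply: measurable_subG => //; apply: measurable_subG => //; exact: measurable_cst.
Qed.

Lemma haar_preimage (A : set G) (h : G) : measurable (A : set (borel G)) ->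
  mu ((fun x : G => x - h) @^-1` A) = mu A.
Proof.
move=> mA; rewrite -(H.2 A h mA); congr (mu _); apply/seteqP; split => x /=.
  by move=> Ax; exists (x - h) => //; rewrite subrK.
by move=> [y Ay <-]; rewrite addrK.
Qed.

Lemma ae_transl (Q : G -> Prop) (h : G) :
  {ae mu, forall x, Q x} -> {ae mu, forall x, Q (x - h)}.
Proof.
move=> [A [mA A0 hA]]; exists ((fun x : G => x - h) @^-1` A); split.
- rewrite -[X in measurable X]setTI.
  apply: (measurable_subG (T := borel G)) => //; exact: measurable_cst.
- by rewrite -A0; exact: haar_preimage.
by move=> x /= ; exact: hA.
Qed.

Lemma mean_subr (u : G -> R) (h : G) : bmeas (u : borel G -> R) ->
  mean mu (fun x => u (x - h)) = mean mu u.
Proof.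
move=> bu; apply/EFin_inj.
have mh : measurable_fun setT (fun x : borel G => (x : G) - h : borel G).
  by apply: measurable_subG => //; exact: measurable_cst.
have bh : bmeas (fun x : borel G => u ((x : G) - h)) by exact: (bmeasT_comp bu mh).
rewrite !EFin_mean //.
have := integral_pushforward mh (mu := mu) (D := setT) (f := EFin \o u).
rewrite preimage_setT => <- //.
- by apply: eq_measure_integral => A mA _; exact: haar_preimage.
- by apply/measurable_EFinP; case: bu.
- exact: (bmeas_integrable mu bh).
Qed.

Lemma mean_addr (u : G -> R) (h : G) : bmeas (u : borel G -> R) ->
  mean mu (fun x => u (x + h)) = mean mu u.
Proof.
by move=> bu; rewrite -(mean_subr (- h) bu); apply: eq_mean => x; rewrite opprK.
Qed.

(* Average [u (y - x)] over the square in both orders. *)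
Lemma mean_subl (u : G -> R) (h : G) : bmeas (u : borel G -> R) ->
  mean mu (fun x => u (h - x)) = mean mu u.
Proof.
move=> bu.
have rec (y : G) : mean mu (fun x => u (y - x)) = mean mu (fun x => u (- x)).
  have bn : bmeas (fun x : borel G => u (- (x : G))).
    apply: (bmeasT_comp bu (g := fun x : borel G => - (x : G) : borel G)).
    have -> : (fun x : borel G => - (x : G)) = (fun x : borel G => (0 : G) - x).
      by apply/funext => x; rewrite sub0r.
    by apply: measurable_subG => //; exact: measurable_cst.
  rewrite -(mean_subr y bn); apply: eq_mean => x.
  by rewrite opprB.
have bU : bmeas (fun z : borel G * borel G => u ((z.1 : G) - z.2)).
  exact: (bmeasT_comp bu (measurable_subG_prod H.1)).
have := mean_swap mu mu bU => /=.
rewrite (@eq_mean _ _ _ mu (fun x => mean mu (fun y => u ((x : G) - y)))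
  (fun=> mean mu (fun x => u (- x)))) // mean_cst rec => ->.
rewrite (@eq_mean _ _ _ mu _ (fun=> mean mu u)) ?mean_cst //.
by move=> y /=; rewrite mean_subr.
Qed.

End HaarGroup.

(** * Averaged iterated differences and smoothness *)

Section IteratedAverage.
Context {R : realType} {G : topologicalZmodType} (mu : probability (borel G) R).
Hypothesis H : haar_group mu.

(** Measurability of a family of functions jointly in parameter and point. Recursive constructions
    differentiate in a new shift at each level, so their measurability has to be proved for families
    over an arbitrary parameter space. *)
Definition jmeas dT (T : measurableType dT) dV (V : measurableType dV)
    (p : T -> G -> V) :=
  measurable_fun setT (fun z : T * borel G => p z.1 z.2).

Lemma jmeas_cst dT (T : measurableType dT) dV (V : measurableType dV)
    (p : G -> V) : measurable_fun setT (p : borel G -> V) ->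
  jmeas (fun _ : T => p).
Proof. by move=> mp; exact: (measurableT_comp mp (@measurable_snd _ _ T _)). Qed.

Lemma measurable_transl dV (V : measurableType dV) (p : G -> V) (h : G) :
  measurable_fun setT (p : borel G -> V) ->
  measurable_fun setT (fun x : borel G => p ((x : G) - h)).
Proof.
move=> mp; apply: (measurableT_comp mp); apply: (measurable_subG H) => //.
Qed.

(** The average over h1, .., hn of [b] applied to the iterated [op]-derivative of [p] at [x]. It is
    used with subtraction of real phases and with [pdif], the product with a conjugate in polar
    coordinates. *)
Fixpoint avg V (op : V -> V -> V) (b : V -> R) (n : nat) (p : G -> V) (x : G) : R :=
  if n is n'.+1 then
    mean mu (fun h => avg op b n' (fun y => op (p (y - h)) (p y)) x)
  else b (p x).

Section Measurability.
Context dV (V : measurableType dV) (op : V -> V -> V) (b : V -> R) (M : R).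
Context (mop : measurable_fun setT (fun z : V * V => op z.1 z.2)).
Context (mb : measurable_fun setT b) (hb : forall v, `|b v| <= M).

Lemma jmeas_op dT (T : measurableType dT) (p : T -> G -> V) : jmeas p ->
  jmeas (fun (z : T * borel G) y => op (p z.1 (y - (z.2 : G))) (p z.1 y)).
Proof.
move=> jp.
have m11 : measurable_fun setT (fun w : (T * borel G) * borel G => w.1.1).
  exact: measurableT_comp.
have ms : measurable_fun setT (fun w : (T * borel G) * borel G =>
    (w.2 : G) - w.1.2 : borel G).
  by apply: (measurable_subG H) => //; exact: measurableT_comp.
exact: (measurableT_comp mop (measurable_fun_pair
  (measurableT_comp jp (measurable_fun_pair m11 ms))
  (measurableT_comp jp (measurable_fun_pair m11 measurable_snd)))).
Qed.

Lemma bmeas_avg_param n : forall dT (T : measurableType dT) (p : T -> G -> V),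
  jmeas p -> bmeas (fun z : T * borel G => avg op b n (p z.1) z.2).
Proof.
elim: n => [|n IH] dT T p jp /=.
  split; first exact: (measurableT_comp mb).
  by exists M.
apply: (bmeas_mean mu (U := fun w : (T * borel G) * borel G =>
  avg op b n (fun y => op (p w.1.1 (y - (w.2 : G))) (p w.1.1 y)) w.1.2)).
(* The shift [w.2] joins the parameter, so the induction hypothesis is applied over
   [T * borel G]. *)
apply: (bmeasT_comp (IH _ _ _ (jmeas_op jp))
  (g := fun w : (T * borel G) * borel G => ((w.1.1, w.2), w.1.2))).
by apply: measurable_fun_pair; [apply: measurable_fun_pair|] => //;
  exact: measurableT_comp.
Qed.

Context (p : G -> V) (mp : measurable_fun setT (p : borel G -> V)).

Lemma bmeas_avg n : bmeas (avg op b n p : borel G -> R).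
Proof.
have := bmeas_avg_param n (jmeas_cst (T := borel G) mp).
move=> bp; apply: (bmeasT_comp bp (g := fun x : borel G => (x, x))).
exact: measurable_fun_pair.
Qed.

Lemma bmeas_avg2 n : bmeas (fun z : borel G * borel G =>
  avg op b n (fun y => op (p (y - (z.1 : G))) (p y)) z.2).
Proof.
apply: (bmeasT_comp (bmeas_avg_param n (jmeas_op (jmeas_cst (T := borel G) mp)))
  (g := fun z : borel G * borel G => ((z.1, z.1), z.2))).
by apply: measurable_fun_pair => //; apply: measurable_fun_pair.
Qed.

Lemma bmeas_avg_h n (x : G) : bmeas (fun h : borel G =>
  avg op b n (fun y => op (p (y - (h : G))) (p y)) x).
Proof. exact: (bmeasT_comp (bmeas_avg2 n) (pair2_measurable (x : borel G))). Qed.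

Lemma bmeas_avg_dif n : bmeas (fun h : borel G =>
  mean mu (avg op b n (fun y => op (p (y - (h : G))) (p y)))).
Proof. exact: (bmeas_mean mu (bmeas_avg2 n)). Qed.

Lemma mean_avgS n : mean mu (avg op b n.+1 p) =
  mean mu (fun h => mean mu (avg op b n (fun y => op (p (y - h)) (p y)))).
Proof. by rewrite -(mean_swap mu mu (bmeas_avg2 n)). Qed.

End Measurability.

Definition dif (h : G) (p : G -> R) : G -> R := fun x => p (x - h) - p x.
Definition avgR (b : R -> R) := avg (fun s t => s - t) b.
(** For n >= 1 and measurable [p] this is 1 minus the 2^n-th power of the U^n norm of e(p). *)
Definition defect n (p : G -> R) : R := mean mu (avgR osc n p).

Lemma measurable_subR : measurable_fun setT (fun z : R * R => z.1 - z.2).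
Proof. exact: measurable_funB. Qed.

Lemma measurable_dif h (p : G -> R) : measurable_fun setT (p : borel G -> R) ->
  measurable_fun setT (dif h p : borel G -> R).
Proof. by move=> mp; apply: measurable_funB => //; exact: measurable_transl. Qed.

Lemma norm_osc_le2 (t : R) : `|osc t| <= 2.
Proof. by rewrite ger0_norm ?osc_ge0 ?osc_le2. Qed.

Lemma bmeas_osc_avg (p : G -> R) n : measurable_fun setT (p : borel G -> R) ->
  bmeas (avgR osc n p : borel G -> R).
Proof.
by move=> mp; exact: (bmeas_avg measurable_subR measurable_osc norm_osc_le2 mp).
Qed.

Lemma bmeas_defect_dif n (p : G -> R) : measurable_fun setT (p : borel G -> R) ->
  bmeas (fun h : borel G => defect n (dif h p)).
Proof.
by move=> mp; exact: (bmeas_avg_dif measurable_subR measurable_osc norm_osc_le2 mp).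
Qed.

Lemma defectS n (p : G -> R) : measurable_fun setT (p : borel G -> R) ->
  defect n.+1 p = mean mu (fun h => defect n (dif h p)).
Proof.
by move=> mp; exact: (mean_avgS measurable_subR measurable_osc norm_osc_le2 mp).
Qed.

Lemma difD h (p r : G -> R) : dif h (fun x => p x + r x) = (fun x => dif h p x + dif h r x).
Proof. by apply/funext => x; rewrite /dif; ring. Qed.

Lemma dif_transl s h (p : G -> R) :
  dif h (fun x => p (x - s)) = (fun x => dif h p (x - s)).
Proof. by apply/funext => x; rewrite /dif addrAC. Qed.

Lemma difC h s (p : G -> R) : dif h (dif s p) = dif s (dif h p).
Proof. by apply/funext => x; rewrite /dif (addrAC x); ring. Qed.

Lemma dif_cocycle h s (p : G -> R) :
  dif h p = (fun x => dif s p x + dif (h - s) p (x - s)).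
Proof.
apply/funext => x; rewrite /dif (_ : x - s - (h - s) = x - h); first by ring.
by rewrite opprB addrA subrK.
Qed.

Lemma avgR_transl b n s (p : G -> R) x :
  avgR b n (fun x => p (x - s)) x = avgR b n p (x - s).
Proof.
rewrite /avgR; elim: n p x => [//|n IH] p x /=; apply: eq_mean => h.
by rewrite -IH -/(dif h _) dif_transl.
Qed.

Lemma defect_transl n s (p : G -> R) : measurable_fun setT (p : borel G -> R) ->
  defect n (fun x => p (x - s)) = defect n p.
Proof.
move=> mp; rewrite /defect.
rewrite -(mean_subr H s (bmeas_osc_avg n mp)); apply: eq_mean => x.
exact: avgR_transl.
Qed.

Lemma bmeas_avg_osc_h n (p : G -> R) x : measurable_fun setT (p : borel G -> R) ->
  bmeas (fun h : borel G => avgR osc n (dif h p) x).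
Proof.
move=> mp; exact: (bmeas_avg_h measurable_subR measurable_osc norm_osc_le2 mp).
Qed.

Lemma avg_osc_ge0 n (p : G -> R) x : 0 <= avgR osc n p x.
Proof.
elim: n p x => [|n IH] p x /=; first exact: osc_ge0.
by apply: mean_ge0 => h; exact: IH.
Qed.

Lemma avg_oscD n (p r : G -> R) x : measurable_fun setT (p : borel G -> R) ->
  measurable_fun setT (r : borel G -> R) ->
  avgR osc n (fun x => p x + r x) x <= 2 * avgR osc n p x + 2 * avgR osc n r x.
Proof.
elim: n p r x => [|n IH] p r x mp mr /=; first exact: oscD.
rewrite /avgR /= -/(avgR osc n).
have bp := bmeas_avg_osc_h n x mp; have br := bmeas_avg_osc_h n x mr.
have b2 := bmeas_cst (T := borel G) (2 : R).
rewrite -!meanZ // -meanD; try exact: bmeasM.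
apply: le_mean; last 1 first.
- by move=> h; rewrite -/(dif h _) difD; apply: IH; exact: measurable_dif.
- by apply: (bmeas_avg_osc_h n x (p := fun x => p x + r x)); exact: measurable_funD.
- by apply: bmeasD; exact: bmeasM.
Qed.

Lemma defectD n (p r : G -> R) : measurable_fun setT (p : borel G -> R) ->
  measurable_fun setT (r : borel G -> R) ->
  defect n (fun x => p x + r x) <= 2 * defect n p + 2 * defect n r.
Proof.
move=> mp mr; have b2 := bmeas_cst (T := borel G) (2 : R).
have bp := bmeas_osc_avg n mp; have br := bmeas_osc_avg n mr.
rewrite /defect -!meanZ // -meanD; try exact: bmeasM.
apply: le_mean; last by move=> x; exact: avg_oscD.
- by apply: bmeas_osc_avg; exact: measurable_funD.
- by apply: bmeasD; exact: bmeasM.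
Qed.

(* By the cocycle identity [dif h p] is controlled by [dif s p] and
   [dif (h - s) p], and both are small for most [s]. *)
Lemma defect_dif_le n (p : G -> R) h : measurable_fun setT (p : borel G -> R) ->
  defect n (dif h p) <= 4 * defect n.+1 p.
Proof.
move=> mp; have bd := bmeas_defect_dif n mp.
have bd' : bmeas (fun s : borel G => defect n (dif (h - (s : G)) p)).
  apply: (bmeasT_comp bd (g := fun s : borel G => h - (s : G) : borel G)).
  by apply: (measurable_subG H) => //; exact: measurable_cst.
have b2 := bmeas_cst (T := borel G) (2 : R).
have -> : 4 * defect n.+1 p = mean mu (fun s =>
    2 * defect n (dif s p) + 2 * defect n (dif (h - s) p)).
  rewrite meanD ?meanZ //; try exact: bmeasM.
  by rewrite (mean_subl H h bd) -defectS //; ring.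
apply: mean_ge_cst => [|s]; first by apply: bmeasD; exact: bmeasM.
rewrite (dif_cocycle h s) (le_trans (defectD _ _ _)) //.
- exact: measurable_dif.
- by apply: measurable_transl; exact: measurable_dif.
by rewrite defect_transl //; exact: measurable_dif.
Qed.

(** All shifts are quantified, not almost all, so that each derivative [dif h p] inherits the
    property one level down with the same [d]. *)
Fixpoint smooth (n : nat) (d : R) (p : G -> R) : Prop :=
  if n is n'.+1 then forall h, smooth n' d (dif h p)
  else mean mu (fun x => osc (p x)) <= d.

(** Fixing one shift costs a factor 4 by [defect_dif_le], and n shifts are fixed in turn. *)
Lemma smooth_of_defect n d (p : G -> R) : measurable_fun setT (p : borel G -> R) ->
  defect n p <= d -> smooth n (4 ^+ n * d) p.
Proof.
elim: n p d => [|n IH] p d mp hp /=; first by rewrite mul1r.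
move=> h; rewrite exprSr -mulrA; apply: IH; first exact: measurable_dif.
by rewrite (le_trans (defect_dif_le _ _ _)) // ler_pM2l.
Qed.

Lemma smooth_transl n d s (p : G -> R) : measurable_fun setT (p : borel G -> R) ->
  smooth n d p -> smooth n d (fun x => p (x - s)).
Proof.
elim: n p => [|n IH] p mp /=.
  by rewrite (mean_subr H s (u := fun x => osc (p x))) //; exact: bmeas_osc.
by move=> hp h; rewrite dif_transl; apply: IH => //; exact: measurable_dif.
Qed.

Lemma smoothB n d (p r : G -> R) : measurable_fun setT (p : borel G -> R) ->
  measurable_fun setT (r : borel G -> R) -> smooth n d p -> smooth n d r ->
  smooth n (4 * d) (fun x => p x - r x).
Proof.
elim: n p r => [|n IH] p r mp mr /= hp hr.
  have bp := bmeas_osc mp; have br := bmeas_osc mr.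
  have b2 := bmeas_cst (T := borel G) (2 : R).
  apply: (@le_trans _ _ (mean mu (fun x => 2 * osc (p x) + 2 * osc (r x)))).
    apply: le_mean => [||x]; last exact: oscB.
      by apply: bmeas_osc; exact: measurable_funB.
    by apply: bmeasD; exact: bmeasM.
  rewrite meanD ?meanZ //; try exact: bmeasM.
  by lra.
move=> h; rewrite (_ : dif h _ = (fun x => dif h p x - dif h r x)).
  by apply: IH => //; exact: measurable_dif.
by apply/funext => x; rewrite /dif; ring.
Qed.

End IteratedAverage.

(** * From nearly vanishing differences to an exact polynomial *)

Section Correction.
Context {R : realType} {G : topologicalZmodType} (mu : probability (borel G) R).
Hypothesis H : haar_group mu.
Implicit Types (p r : G -> R) (hs : seq G).

Lemma diff_iter_dif hs h p : diff_iter hs (dif h p) = dif h (diff_iter hs p).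
Proof. by elim: hs => [//|h' hs IH] /=; rewrite IH -/(dif h' _) difC. Qed.

Lemma diff_iterB hs p r :
  diff_iter hs (fun x => p x - r x) = (fun x => diff_iter hs p x - diff_iter hs r x).
Proof.
by elim: hs => [//|h hs IH] /=; rewrite IH; apply/funext => x; ring.
Qed.

Lemma diff_iterZ hs c p :
  diff_iter hs (fun x => c * p x) = (fun x => c * diff_iter hs p x).
Proof.
by elim: hs => [//|h hs IH] /=; rewrite IH; apply/funext => x; ring.
Qed.

Lemma bmeas_diff_iter (F : G -> G -> R) hs :
  (forall x, bmeas (fun h : borel G => F h x)) ->
  forall x, bmeas (fun h : borel G => diff_iter hs (F h) x).
Proof. by move=> bF; elim: hs => [//|h hs IH] x /=; exact: bmeasB. Qed.

Lemma diff_iter_mean (F : G -> G -> R) hs :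
  (forall x, bmeas (fun h : borel G => F h x)) ->
  forall x, diff_iter hs (fun y => mean mu (fun h => F h y)) x =
    mean mu (fun h => diff_iter hs (F h) x).
Proof.
move=> bF; elim: hs => [//|h hs IH] x /=.
by rewrite !IH -meanB //; exact: bmeas_diff_iter.
Qed.

Lemma bmeas_avg_cent_h n p x : measurable_fun setT (p : borel G -> R) ->
  bmeas (fun h : borel G => avgR mu cent n (dif h p) x).
Proof.
by move=> mp; exact: (bmeas_avg_h H measurable_subR measurable_cent cent_norm mp).
Qed.

(* Both sides agree modulo 1 and differ by at most 3/4. *)
Lemma centB_small (a b c : R) : osc (a - c) <= 1 -> osc (b - c) <= 1 ->
  osc (a - b) <= 1 -> cent (a - b) = cent (a - c) - cent (b - c).
Proof.
move=> /cent_quarter ha /cent_quarter hb /cent_quarter hab.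
have [i iE] := centE (a - b); have [j jE] := centE (a - c).
have [k kE] := centE (b - c).
suff e0 : i - j + k = 0.
  have : (i - j + k)%:~R = 0 :> R by rewrite e0.
  by rewrite intrD intrB iE jE kE; lra.
apply: (@int_small R); rewrite intrD intrB.
have -> : i%:~R - j%:~R + k%:~R = cent (a - b) - cent (a - c) + cent (b - c) :> R.
  by rewrite iE jE kE; ring.
move: ha hb hab; rewrite !ler_norml ltr_norml => /andP[? ?] /andP[? ?] /andP[? ?].
by apply/andP; split; lra.
Qed.

(** With [th] the inner n-fold difference of [p], the function [la] is a real lift of [th - th 0]
    modulo 1 whose increments are exactly the small representatives, by [centB_small]. Averaging
    these increments over the first shift gives the mean of [la] minus [la]; one more difference
    kills the mean and leaves minus a representative, whence the sign. *)
Lemma diff_iter_avg_cent n p : measurable_fun setT (p : borel G -> R) ->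
  (forall hs, size hs = n -> forall x, osc (diff_iter hs p x) <= 1) ->
  forall hs, size hs = n -> forall x,
    diff_iter hs (avgR mu cent n p) x = (-1) ^+ n * cent (diff_iter hs p x).
Proof.
elim: n p => [|n IH] p mp hp [|h0 hs] //= => [_ x|[shs] x]; first by rewrite mul1r.
pose th := diff_iter hs p.
(* Any increment of [th] is an (n+1)-fold difference of [p], with shift z - y at the point z. *)
have thB y z : osc (th y - th z) <= 1.
  have := hp ((z - y) :: hs) (congr1 S shs) z; rewrite /= -/th.
  by rewrite subKr.
pose la y := cent (th y - th 0).
have mth : measurable_fun setT (th : borel G -> R).
  by rewrite /th; elim: (hs) => [//|h l IHl] /=; exact: (measurable_dif H).
have bla : bmeas (la : borel G -> R).
  by apply: bmeas_cent; apply: measurable_funB.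
have key y : diff_iter hs (avgR mu cent n.+1 p) y =
    (-1) ^+ n * (mean mu la - la y).
  rewrite (diff_iter_mean (F := fun h => avgR mu cent n (dif h p))); last first.
    by move=> z; exact: bmeas_avg_cent_h.
  rewrite (@eq_mean _ _ _ mu _ (fun h => (-1) ^+ n * (la (y - h) - la y))).
    have bl := bmeas_cst (T := borel G) (la y).
    have bs : bmeas (fun h : borel G => la (y - (h : G))).
      apply: (bmeasT_comp bla (g := fun h : borel G => y - (h : G) : borel G)).
      by apply: (measurable_subG H) => //; exact: measurable_cst.
    rewrite meanZ; last exact: bmeasB.
    by rewrite meanB // (mean_subl H y bla) mean_cst.
  move=> h; rewrite IH //; first by rewrite diff_iter_dif /dif -/th (centB_small (thB _ 0) (thB _ 0)).
    exact: (measurable_dif H).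
  move=> l sl z; rewrite diff_iter_dif.
  exact: (hp (h :: l) (congr1 S sl)).
rewrite -/(avgR mu cent n.+1 p) !key -/th exprS (centB_small (thB _ 0) (thB _ 0)) //.
by rewrite /la; ring.
Qed.

Lemma avg_cent_norm n p (c : R) x : measurable_fun setT (p : borel G -> R) ->
  (forall hs, size hs = n -> `|cent (diff_iter hs p x)| <= c) ->
  `|avgR mu cent n p x| <= c.
Proof.
elim: n p => [|n IH] p mp hp /=; first exact: (hp [::]).
apply: mean_norm_le; first exact: bmeas_avg_cent_h.
move=> h; apply: IH; first exact: (measurable_dif H).
by move=> hs shs; rewrite diff_iter_dif; exact: (hp (h :: hs) (congr1 S shs)).
Qed.

(** By [diff_iter_avg_cent], subtracting (-1)^n times the averaged representatives replaces each
    n-fold difference t by t - [cent t], an integer. *)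
Lemma exact_polynomial n p (d : R) : measurable_fun setT (p : borel G -> R) ->
  d <= 1 ->
  (forall hs, size hs = n -> forall x, osc (diff_iter hs p x) <= d) ->
  exists P : G -> R, [/\ measurable_fun setT (P : borel G -> R),
    forall hs, size hs = n -> forall x, exists z : int, diff_iter hs P x = z%:~R &
    forall x, osc (p x - P x) <= d].
Proof.
move=> mp d1 hp.
have d0 : 0 <= d.
  by apply: le_trans (hp (nseq n 0) _ 0); [exact: osc_ge0|rewrite size_nseq].
have hp1 hs (shs : size hs = n) x : osc (diff_iter hs p x) <= 1.
  exact: le_trans (hp hs shs x) d1.
exists (fun x => p x - (-1) ^+ n * avgR mu cent n p x); split.
- apply: measurable_funB => //; apply: measurable_funM => //.
  by case: (bmeas_avg H (op := fun s t : R => s - t) measurable_subR measurable_cent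
    cent_norm mp n).
- move=> hs shs x; rewrite diff_iterB diff_iterZ diff_iter_avg_cent //.
  rewrite mulrA -exprMn mulrNN mulr1 expr1n mul1r.
  have [z ->] := centE (diff_iter hs p x); exists (- z).
  by rewrite mulrNz opprD addrA subrr add0r.
move=> x; rewrite opprB addrC subrK.
(* The bound [d] on [osc] becomes a bound [c] on the representatives, passes to their average, and
   is turned back into [d] at the end. *)
have [c [c0 c2 cE]] := osc_preimage d0 d1.
have cn : `|c| = c by rewrite ger0_norm.
have n1 : `|(-1) ^+ n * avgR mu cent n p x| <= c.
  rewrite normrM normrX normrN normr1 expr1n mul1r; apply: avg_cent_norm => //.
  move=> hs shs; have := hp hs shs x.
  by rewrite -osc_cent -cE osc_le_norm ?cn ?cent_norm.
by rewrite -cE osc_le_norm ?cn // (le_trans n1).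
Qed.
End Correction.

(** * The direction of the centre of mass on the circle *)

Section Centre.
Context {R : realType} {d : measure_display} {T : measurableType d}.
Context (P : probability T R).
Implicit Types u v : T -> R.

Lemma oscD3 (a b c : R) : osc (a + b + c) <= 4 * osc a + 4 * osc b + 4 * osc c.
Proof.
have := oscD (a + b) c; have := oscD a b; have := osc_ge0 c; lra.
Qed.

Lemma oscD4 (a b c e : R) :
  osc (a + b + (c + e)) <= 4 * osc a + 4 * osc b + 4 * osc c + 4 * osc e.
Proof. by have := oscD (a + b) (c + e); have := oscD a b; have := oscD c e; lra. Qed.

(** By [mean_osc_sub] this phase minimises the mean of [osc (u - c)] over all c. *)
Definition centre u := arg (mean P (cosc \o u)) (mean P (sinc \o u)).

Lemma mean_osc_sub u c : measurable_fun setT u -> mean P (fun x => osc (u x - c)) =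
  1 - (mean P (cosc \o u) * cosc c + mean P (sinc \o u) * sinc c).
Proof.
move=> mu; have bc := bmeas_cosc mu; have bs := bmeas_sinc mu.
have b1 (e : R) := bmeas_cst (T := T) e.
rewrite (@eq_mean _ _ _ P _ (fun x => 1 -
    (cosc c * (cosc \o u) x + sinc c * (sinc \o u) x))); last first.
  by move=> x; rewrite /osc coscB /=; ring.
rewrite meanB ?mean_cst ?meanD ?meanZ //; try (by apply: bmeasM); last first.
  by apply: bmeasD; exact: bmeasM.
by ring.
Qed.

(* With [r] the length of the mean of [e(u)], the left side is [1 - r] and the
   right side [1 - r ^ 2]. *)
Lemma centreP u : measurable_fun setT u ->
  mean P (fun x => osc (u x - centre u)) <=
  mean P (fun y => mean P (fun x => osc (u x - u y))).
Proof.
move=> mu; have bc := bmeas_cosc mu; have bs := bmeas_sinc mu.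
have b1 (e : R) := bmeas_cst (T := T) e.
pose C := mean P (cosc \o u); pose S := mean P (sinc \o u).
have -> : mean P (fun y => mean P (fun x => osc (u x - u y))) = 1 - (C ^+ 2 + S ^+ 2).
  rewrite (@eq_mean _ _ _ P _ (fun y => 1 -
      (C * (cosc \o u) y + S * (sinc \o u) y))); last first.
    by move=> y; rewrite mean_osc_sub.
  rewrite meanB ?mean_cst ?meanD ?meanZ //; try (by apply: bmeasM); last first.
    by apply: bmeasD; exact: bmeasM.
rewrite mean_osc_sub // -/C -/S /centre -/C -/S.
have [CE SE] := argP C S; have := cosc_sinc_sqr (arg C S).
have := sqrtr_ge0 (C ^+ 2 + S ^+ 2); move: CE SE.
have C1 : `|C| <= 1 by apply: mean_norm_le => // x; exact: cos_max.
move: (Num.sqrt _) => r; set c := cosc _; set s := sinc _ => CE SE r0 cs.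
have CSr : C * c + S * s = r.
  by rewrite CE SE -[RHS]mulr1 -cs; ring.
have CSr2 : C ^+ 2 + S ^+ 2 = r ^+ 2.
  by rewrite [in LHS]CE [in LHS]SE -[RHS]mulr1 -cs; ring.
have : 0 <= mean P (fun x => osc (u x - arg C S)).
  by apply: mean_ge0 => x; exact: osc_ge0.
rewrite mean_osc_sub // -/C -/S -/c -/s CSr CSr2 => r1.
by rewrite lerD2l lerN2 expr2 ler_piMl //; lra.
Qed.

End Centre.

(** * The majority vote and its measurability *)

Section Vote.
Context {R : realType} {G : topologicalZmodType} (mu : probability (borel G) R).
Hypothesis H : haar_group mu.
Implicit Types (p r : G -> R).

(** Since p(x) = p(x - s) - [dif s p x], each [s] casts a ballot for the value p(x), with the
    unknown [dif s p x] replaced by its own vote one level down. At level 0 the vote is 0, because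
    [smooth] then says that [p] itself is close to 0 modulo 1. *)
Fixpoint vote n p (x : G) : R :=
  if n is n'.+1 then centre mu (fun s => p (x - s) - vote n' (dif s p) x) else 0.

Lemma jmeas_dif dT (T : measurableType dT) (p : T -> G -> R) : jmeas p ->
  jmeas (fun z : T * borel G => dif z.2 (p z.1)).
Proof. by move=> jp; exact: (jmeas_op H (op := fun s t : R => s - t) measurable_subR jp). Qed.

(** Measurability of the level [n] votes is a hypothesis, so that the lemma serves both inside the
    induction of [measurable_vote_param] and after it. *)
Lemma measurable_ballot n dT (T : measurableType dT) (p : T -> G -> R) :
  (forall dT (T : measurableType dT) (p : T -> G -> R), jmeas p ->
    measurable_fun setT (fun z : T * borel G => vote n (p z.1) z.2)) ->
  jmeas p -> measurable_fun setT (fun w : (T * borel G) * borel G =>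
    p w.1.1 ((w.1.2 : G) - w.2) - vote n (dif w.2 (p w.1.1)) w.1.2).
Proof.
move=> IH jp.
have m11 : measurable_fun setT (fun w : (T * borel G) * borel G => w.1.1).
  exact: measurableT_comp.
have m12 : measurable_fun setT (fun w : (T * borel G) * borel G => w.1.2).
  exact: measurableT_comp.
apply: measurable_funB.
  apply: (measurableT_comp jp (measurable_fun_pair m11 _)).
  exact: (measurable_subG H).
exact: (measurableT_comp (IH _ _ _ (jmeas_dif jp))
  (measurable_fun_pair (measurable_fun_pair m11 measurable_snd) m12)).
Qed.

Lemma measurable_vote_param n : forall dT (T : measurableType dT) (p : T -> G -> R),
  jmeas p -> measurable_fun setT (fun z : T * borel G => vote n (p z.1) z.2).
Proof.
elim: n => [|n IH] dT T p jp /=; first exact: measurable_cst.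
have mb := measurable_ballot IH jp.
apply: measurable_arg.
  by case: (bmeas_mean mu (bmeas_cosc mb)).
by case: (bmeas_mean mu (bmeas_sinc mb)).
Qed.

Lemma measurable_vote n p : measurable_fun setT (p : borel G -> R) ->
  measurable_fun setT (vote n p : borel G -> R).
Proof.
move=> mp; have := measurable_vote_param n (jmeas_cst (T := borel G) mp).
move=> mv; exact: (measurableT_comp mv (measurable_fun_pair
  (@measurable_id _ (borel G) setT) (@measurable_id _ (borel G) setT))).
Qed.

Definition ballot n p x s := p (x - s) - vote n (dif s p) x.

Lemma measurable_ballot2 n p : measurable_fun setT (p : borel G -> R) ->
  measurable_fun setT (fun z : borel G * borel G => ballot n p z.1 z.2).
Proof.
move=> mp; have := measurable_ballot (measurable_vote_param n) (jmeas_cst (T := borel G) mp).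
move=> mb; exact: (measurableT_comp mb (measurable_fun_pair
  (measurable_fun_pair measurable_fst measurable_fst) measurable_snd)).
Qed.

Lemma measurable_ballot1 n p x : measurable_fun setT (p : borel G -> R) ->
  measurable_fun setT (fun s : borel G => ballot n p x s).
Proof.
move=> mp; exact: (measurableT_comp (measurable_ballot2 n mp) (pair1_measurable (x : borel G))).
Qed.

Lemma vote_transl n s p x : vote n (fun y => p (y - s)) x = vote n p (x - s).
Proof.
elim: n p x => [//|n IH] p x /=; congr centre; apply/funext => h.
by rewrite dif_transl IH addrAC.
Qed.

End Vote.

(** * The inductive step for the majority vote *)

Section VoteStep.
Context {R : realType} {G : topologicalZmodType} (mu : probability (borel G) R).
Hypothesis H : haar_group mu.
Implicit Types (p r : G -> R).

(** This is required at every point, whereas [vote_close] is only in mean. The two go through the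
    induction together, since the concentration of ballots uses both. *)
Definition vote_additive n (C : R) := forall d p r,
  measurable_fun setT (p : borel G -> R) -> measurable_fun setT (r : borel G -> R) ->
  smooth mu n d p -> smooth mu n d r -> forall x,
  osc (vote mu n (fun y => p y - r y) x - vote mu n p x + vote mu n r x) <= C * d.

Definition vote_close n (C : R) := forall d p,
  measurable_fun setT (p : borel G -> R) -> smooth mu n d p ->
  mean mu (fun x => osc (p x - vote mu n p x)) <= C * d.

Context (n : nat) (C : R).
Context (Hadd : vote_additive n C) (Hclose : vote_close n C).

Let b2 (c : R) := bmeas_cst (T := borel G) c.

(** By [centreP] it is enough to compare the ballots of t + y and y. With q = [dif t p], they differ
    by the error of the vote on q at x - y, small on average over y by closeness, plus an additivity
    error, small at every point. Each contributes 2 C d. *)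
Lemma ballot_concentrated d p x : measurable_fun setT (p : borel G -> R) ->
  smooth mu n.+1 d p ->
  mean mu (fun s => osc (ballot mu n p x s - vote mu n.+1 p x)) <= 4 * C * d.
Proof.
move=> mp sp; have mb := measurable_ballot1 H n x mp.
apply: le_trans (centreP mu mb) _.
have mdiff : measurable_fun setT (fun z : borel G * borel G =>
    ballot mu n p x ((z.2 : G) + z.1) - ballot mu n p x z.1).
  apply: measurable_funB; last exact: (measurableT_comp mb).
  by apply: (measurableT_comp mb); apply: (measurable_addG H).
rewrite (@eq_mean _ _ _ mu _ (fun y => mean mu (fun t =>
    osc (ballot mu n p x (t + y) - ballot mu n p x y)))); last first.
  move=> y; rewrite -(mean_addr H y (u := fun s =>
    osc (ballot mu n p x s - ballot mu n p x y))) //.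
  by apply: bmeas_osc; exact: measurable_funB.
rewrite (mean_swap mu mu (bmeas_osc mdiff)) /=.
apply: mean_le_cst => [|t].
  apply: (bmeas_mean mu (U := fun z : borel G * borel G =>
    osc (ballot mu n p x ((z.1 : G) + z.2) - ballot mu n p x z.2))).
  exact: (bmeasT_comp (bmeas_osc mdiff) (measurable_fun_pair measurable_snd measurable_fst)).
pose q := dif t p.
have mq : measurable_fun setT (q : borel G -> R) by exact: (measurable_dif H).
have be : bmeas (fun y : borel G => osc (q y - vote mu n q y)).
  by apply: bmeas_osc; apply: measurable_funB => //; exact: (measurable_vote H).
have bs : bmeas (fun y : borel G => osc (q (x - (y : G)) - vote mu n q (x - (y : G)))).
  apply: (bmeasT_comp be (g := fun y : borel G => x - (y : G) : borel G)).
  by apply: (measurable_subG H) => //; exact: measurable_cst.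
apply: (@le_trans _ _ (mean mu (fun y => 2 * osc (q (x - y) - vote mu n q (x - y)) + 2 * (C * d)))).
  apply: le_mean => [||y].
  - exact: (bmeasT_comp (bmeas_osc mdiff) (pair2_measurable (t : borel G))).
  - by apply: bmeasD; [exact: bmeasM|exact: b2].
  have -> : ballot mu n p x (t + y) - ballot mu n p x y =
      (q (x - y) - vote mu n q (x - y)) +
      (vote mu n (fun z => dif (t + y) p z - dif y p z) x -
       vote mu n (dif (t + y) p) x + vote mu n (dif y p) x).
    rewrite -(vote_transl mu n y q) /ballot.
    have -> : (fun z => dif (t + y) p z - dif y p z) = (fun z => q (z - y)).
      apply/funext => z; rewrite /q /dif opprD addrA (addrAC z); ring.
    by rewrite /q /dif opprD addrA (addrAC x); ring.
  apply: (le_trans (oscD _ _)); rewrite lerD2l ler_pM2l //.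
  by apply: Hadd => //; exact: (measurable_dif H).
rewrite meanD ?mean_cst ?meanZ //; last exact: bmeasM.
rewrite (mean_subl H x be).
by have := Hclose mq (sp t); lra.
Qed.

(** The ballot of s at x - h and the ballot of s + h at x both start from p(x - h - s), so they
    differ only by lower votes, to which additivity applies. Two concentration errors and one
    additivity error, each weighted by 4, give 16 + 16 + 4 = 36. *)
Lemma vote_dif d p h x : measurable_fun setT (p : borel G -> R) ->
  smooth mu n.+1 d p ->
  osc (dif h (vote mu n.+1 p) x - vote mu n (dif h p) x) <= 36 * C * d.
Proof.
move=> mp sp.
have mb y := measurable_ballot1 H n y mp.
have mbh : measurable_fun setT (fun s : borel G => ballot mu n p x ((s : G) + h)).
  by apply: (measurableT_comp (mb x)); apply: (measurable_addG H) => //; exact: measurable_cst.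
have bA : bmeas (fun s : borel G => osc (ballot mu n p (x - h) s - vote mu n.+1 p (x - h))).
  by apply: bmeas_osc; exact: measurable_funB.
have bB' : bmeas (fun s : borel G => osc (ballot mu n p x s - vote mu n.+1 p x)).
  by apply: bmeas_osc; exact: measurable_funB.
have bB : bmeas (fun s : borel G => osc (ballot mu n p x ((s : G) + h) - vote mu n.+1 p x)).
  by apply: bmeas_osc; exact: measurable_funB.
apply: (@le_trans _ _ (mean mu (fun s =>
    4 * osc (ballot mu n p (x - h) s - vote mu n.+1 p (x - h)) +
    4 * osc (ballot mu n p x (s + h) - vote mu n.+1 p x) + 4 * (C * d)))).
  apply: mean_ge_cst => [|s].
    by apply: bmeasD; [apply: bmeasD; exact: bmeasM|exact: b2].
  pose al := dif (s + h) p; pose be := fun y => dif s p (y - h).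
  have -> : dif h (vote mu n.+1 p) x - vote mu n (dif h p) x =
      - (ballot mu n p (x - h) s - vote mu n.+1 p (x - h)) +
      (ballot mu n p x (s + h) - vote mu n.+1 p x) +
      - (vote mu n (fun z => al z - be z) x - vote mu n al x + vote mu n be x).
    have -> : (fun z => al z - be z) = dif h p.
      by apply/funext => z; rewrite /al /be /dif opprD addrA (addrAC z); ring.
    have -> : vote mu n be x = vote mu n (dif s p) (x - h) by exact: vote_transl.
    have xE : x - (s + h) = x - h - s by rewrite opprD addrA addrAC.
    by rewrite /ballot /al xE {1}/dif; ring.
  apply: (le_trans (oscD3 _ _ _)); rewrite !oscN lerD2l ler_pM2l //.
  apply: Hadd => //; first exact: (measurable_dif H).
  - by apply: (measurable_transl H); exact: (measurable_dif H).
  - exact: sp.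
  - exact: (smooth_transl H h (measurable_dif H s mp) (sp s)).
rewrite !meanD ?mean_cst ?meanZ //; try exact: bmeasM; last by apply: bmeasD; exact: bmeasM.
rewrite (mean_addr H h bB').
apply: (@le_trans _ _ (4 * (4 * C * d) + 4 * (4 * C * d) + 4 * (C * d))); last by lra.
by rewrite lerD2r lerD // ler_pM2l //; exact: ballot_concentrated.
Qed.

(** Ballots for p - r are differences of ballots for p and r, up to additivity one level down. As p
    - r is only smooth with 4 d, the errors add up to 64 + 16 + 16 + 4 = 100. *)
Lemma vote_additiveS : vote_additive n.+1 (100 * C).
Proof.
move=> d p r mp mr sp sr x; pose w := fun y => p y - r y.
have mw : measurable_fun setT (w : borel G -> R) by exact: measurable_funB.
have sw : smooth mu n.+1 (4 * d) w by exact: (smoothB H).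
have bc q : measurable_fun setT (q : borel G -> R) ->
    bmeas (fun s : borel G => osc (ballot mu n q x s - vote mu n.+1 q x)).
  move=> mq; apply: bmeas_osc; apply: measurable_funB => //.
  exact: (measurable_ballot1 H).
have bp := bc p mp; have br := bc r mr; have bw := bc w mw.
apply: (@le_trans _ _ (mean mu (fun s =>
    4 * osc (ballot mu n w x s - vote mu n.+1 w x) +
    4 * osc (ballot mu n p x s - vote mu n.+1 p x) +
    4 * osc (ballot mu n r x s - vote mu n.+1 r x) + 4 * (C * d)))).
  apply: mean_ge_cst => [|s].
    by apply: bmeasD; [apply: bmeasD; [apply: bmeasD|]; exact: bmeasM|exact: b2].
  have -> : vote mu n.+1 w x - vote mu n.+1 p x + vote mu n.+1 r x =
      (- (ballot mu n w x s - vote mu n.+1 w x) +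
      (ballot mu n p x s - vote mu n.+1 p x)) +
      (- (ballot mu n r x s - vote mu n.+1 r x) +
      - (vote mu n (fun z => dif s p z - dif s r z) x - vote mu n (dif s p) x +
         vote mu n (dif s r) x)).
    rewrite /ballot (_ : dif s w = (fun z => dif s p z - dif s r z)); last first.
      by apply/funext => z; rewrite /dif /w; ring.
    by rewrite /w; ring.
  apply: (le_trans (oscD4 _ _ _ _)); rewrite !oscN lerD2l ler_pM2l //.
  by apply: Hadd => //; exact: (measurable_dif H).
have bM c (f : borel G -> R) : bmeas f -> bmeas (fun s => c * f s).
  by move=> bf; exact: bmeasM.
rewrite meanD ?mean_cst; [|by apply: bmeasD; [apply: bmeasD|]; exact: bM|exact: b2].
rewrite meanD ?meanZ //; [|by apply: bmeasD; exact: bM|exact: bM].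
rewrite meanD ?meanZ //; [|exact: bM|exact: bM].
apply: (@le_trans _ _ (4 * (4 * C * (4 * d)) + 4 * (4 * C * d) + 4 * (4 * C * d) +
    4 * (C * d))); last by lra.
by rewrite lerD2r !lerD // ler_pM2l //; exact: ballot_concentrated.
Qed.

(** The distance from p(x) to the ballot of s is the error of the vote on [dif s p] at x, small on
    average over x for each fixed s; concentration then leads to the vote. This gives 10 C d,
    rounded up to share the constant of [vote_additiveS]. *)
Lemma vote_closeS : vote_close n.+1 (100 * C).
Proof.
move=> d p mp sp.
have mvp : measurable_fun setT (fun x : borel G => vote mu n.+1 p x).
  exact: (measurable_vote H).
have mb2 := measurable_ballot2 H n mp.
have bU : bmeas (fun z : borel G * borel G => osc (p z.1 - ballot mu n p z.1 z.2)).
  by apply: bmeas_osc; apply: measurable_funB => //; exact: (measurableT_comp mp).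
have bV : bmeas (fun z : borel G * borel G =>
    osc (ballot mu n p z.1 z.2 - vote mu n.+1 p z.1)).
  by apply: bmeas_osc; apply: measurable_funB => //; exact: (measurableT_comp mvp).
have bU1 := bmeas_mean mu bU; have bV1 := bmeas_mean mu bV.
apply: (@le_trans _ _ (mean mu (fun x =>
    2 * mean mu (fun s => osc (p x - ballot mu n p x s)) +
    2 * mean mu (fun s => osc (ballot mu n p x s - vote mu n.+1 p x))))).
  apply: le_mean => [||x].
  - by apply: bmeas_osc; exact: measurable_funB.
  - by apply: bmeasD; exact: bmeasM.
  have bUx := bmeasT_comp bU (pair1_measurable (x : borel G)).
  have bVx := bmeasT_comp bV (pair1_measurable (x : borel G)).
  rewrite -!meanZ // -meanD; try exact: bmeasM.
  apply: mean_ge_cst => [|s]; first by apply: bmeasD; exact: bmeasM.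
  apply: le_trans (oscD _ _); rewrite (_ : _ + _ = p x - vote mu n.+1 p x) //.
  by ring.
rewrite meanD ?meanZ //; try exact: bmeasM.
have hU : mean mu (fun x => mean mu (fun s => osc (p x - ballot mu n p x s))) <= C * d.
  rewrite (mean_swap mu mu bU) /=; apply: mean_le_cst => [|s].
    apply: (bmeas_mean mu (U := fun z : borel G * borel G => osc (p z.2 - ballot mu n p z.2 z.1))).
    exact: (bmeasT_comp bU (measurable_fun_pair measurable_snd measurable_fst)).
  have := Hclose (measurable_dif H s mp) (sp s); apply: le_trans.
  rewrite le_eqVlt; apply/orP; left; apply/eqP; apply: eq_mean => x.
  by rewrite -oscN /ballot /dif; congr osc; ring.
have hV : mean mu (fun x => mean mu (fun s =>
    osc (ballot mu n p x s - vote mu n.+1 p x))) <= 4 * C * d.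
  by apply: mean_le_cst => // x; exact: ballot_concentrated.
have Cd0 : 0 <= C * d.
  by apply: le_trans hU; apply: mean_ge0 => x; apply: mean_ge0 => s; exact: osc_ge0.
apply: (@le_trans _ _ (2 * (C * d) + 2 * (4 * C * d))); last by lra.
by rewrite lerD // ler_pM2l.
Qed.

End VoteStep.

(** * Exact polynomials near a phase of small defect *)

Section NearPolynomial.
Context {R : realType} {G : topologicalZmodType} (mu : probability (borel G) R).
Hypothesis H : haar_group mu.
Implicit Types (p r : G -> R).

Lemma vote_additive_close n :
  vote_additive mu n (100 ^+ n) /\ vote_close mu n (100 ^+ n).
Proof.
elim: n => [|n [IHa IHc]].
  split=> d p.
    move=> r mp mr sp _ x /=; rewrite subrr addr0 osc0 mul1r.
    by apply: le_trans sp; apply: mean_ge0 => y; exact: osc_ge0.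
  move=> mp /= sp; rewrite mul1r; apply: le_trans sp.
  by rewrite le_eqVlt; apply/orP; left; apply/eqP; apply: eq_mean => x; rewrite subr0.
by rewrite exprS; split; [exact: vote_additiveS|exact: vote_closeS].
Qed.

Lemma osc_diff_iter hs (e : G -> R) c : (forall x, osc (e x) <= c) ->
  forall x, osc (diff_iter hs e x) <= 4 ^+ size hs * c.
Proof.
move=> he; elim: hs => [|h hs IH] x /=; first by rewrite mul1r.
apply: (le_trans (oscB _ _)); have := IH (x - h); have := IH x.
by rewrite exprS -mulrA; lra.
Qed.

(** The derivative of a vote is the lower vote on the derivative, up to the uniform error [e] of
    [vote_dif]. The n remaining differences multiply that error by 4^n, to 36 times 400^n times d,
    and 2 (72 + 36) is at most 72 times 400. *)
Lemma vote_diff_iter n d p : measurable_fun setT (p : borel G -> R) ->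
  0 <= d -> smooth mu n d p -> forall hs, size hs = n -> forall x,
  osc (diff_iter hs (vote mu n p) x) <= 72 * 400 ^+ n * d.
Proof.
elim: n p => [|n IH] p mp d0 sp [|h hs] //= => [_ x|[shs] x].
  by rewrite osc0 expr0 mulr1 mulr_ge0.
pose e x := vote mu n (dif h p) x - dif h (vote mu n.+1 p) x.
have [Ha Hc] := vote_additive_close n.
have eP y : osc (e y) <= 36 * 100 ^+ n * d.
  rewrite /e -oscN opprB.
  exact: (vote_dif H Ha Hc h y mp sp).
have := osc_diff_iter hs eP x.
have mdp : measurable_fun setT (dif h p : borel G -> R) by exact: (measurable_dif H).
have := IH _ mdp d0 (sp h) hs shs x.
have -> : diff_iter hs (vote mu n.+1 p) (x - h) - diff_iter hs (vote mu n.+1 p) x =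
    diff_iter hs (vote mu n (dif h p)) x - diff_iter hs e x.
  rewrite -[LHS]/(dif h (diff_iter hs (vote mu n.+1 p)) x) -diff_iter_dif.
  rewrite (_ : dif h _ = (fun x => vote mu n (dif h p) x - e x)) ?diff_iterB //.
  by apply/funext => y; rewrite /e; ring.
rewrite shs => h1 h2; apply: (le_trans (oscB _ _)).
have E : 4 ^+ n * (36 * 100 ^+ n * d) = 36 * (400 ^+ n * d).
  rewrite (_ : 400 = 4 * 100) ?exprMn; first by ring.
  by rewrite -natrM.
have P0 : 0 <= 400 ^+ n * d by rewrite mulr_ge0 // exprn_ge0.
apply: (@le_trans _ _ (2 * (72 * 400 ^+ n * d) + 2 * (36 * (400 ^+ n * d)))).
  by rewrite lerD // ler_pM2l // -E.
by rewrite exprS; move: P0; lra.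
Qed.

Lemma near_polynomial n p d : measurable_fun setT (p : borel G -> R) ->
  defect mu n p <= d ->
  exists P : G -> R, [/\ measurable_fun setT (P : borel G -> R),
    forall hs, size hs = n -> forall x, exists z : int, diff_iter hs P x = z%:~R &
    mean mu (fun x => osc (p x - P x)) <= 146 * 1600 ^+ n * d].
Proof.
move=> mp hp.
have d0 : 0 <= d.
  by apply: le_trans hp; apply: mean_ge0 => x; exact: avg_osc_ge0.
have E16 : 1600 ^+ n = 4 ^+ n * 400 ^+ n :> R by rewrite -exprMn -natrM.
have E4 : 400 ^+ n = 4 ^+ n * 100 ^+ n :> R by rewrite -exprMn -natrM.
have sp := smooth_of_defect H mp hp.
have d4 : 0 <= 4 ^+ n * d by rewrite mulr_ge0 // exprn_ge0.
have hv := vote_diff_iter mp d4 sp.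
(* The correction needs a bound of at most 1. When it fails, the claimed bound exceeds 2 and the
   zero polynomial will do. *)
have [small|big] := leP (72 * 400 ^+ n * (4 ^+ n * d)) 1; last first.
  exists (fun=> 0); split; first exact: measurable_cst.
    move=> hs _ x; exists 0.
    by elim: hs x => [//|h hs IH] x /=; rewrite !IH subrr.
  apply: (@le_trans _ _ 2).
    apply: mean_le_cst => [|x]; last exact: osc_le2.
    by apply: bmeas_osc; apply: measurable_funB => //; exact: measurable_cst.
  have -> : 146 * 1600 ^+ n * d = 2 * (72 * 400 ^+ n * (4 ^+ n * d)) +
     2 * (400 ^+ n * (4 ^+ n * d)) by rewrite E16; ring.
  have : 0 <= 400 ^+ n * (4 ^+ n * d) by rewrite mulr_ge0 // exprn_ge0.
  by move: big; lra.
have mv : measurable_fun setT (vote mu n p : borel G -> R) by exact: (measurable_vote H).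
have [P [mP iP cP]] := exact_polynomial H mv small hv.
exists P; split => //.
have b1 : bmeas (fun x : borel G => osc (p x - vote mu n p x)).
  by apply: bmeas_osc; exact: measurable_funB.
have b2 := bmeas_cst (T := borel G) (2 : R).
have bc c := bmeas_cst (T := borel G) (c : R).
apply: (@le_trans _ _ (mean mu (fun x => 2 * osc (p x - vote mu n p x) +
    2 * (72 * 400 ^+ n * (4 ^+ n * d))))).
  apply: le_mean => [||x].
  - by apply: bmeas_osc; exact: measurable_funB.
  - by apply: bmeasD; [exact: bmeasM|exact: bc].
  rewrite (_ : p x - P x = (p x - vote mu n p x) + (vote mu n p x - P x)); last by ring.
  by apply: (le_trans (oscD _ _)); rewrite lerD2l ler_pM2l.
rewrite meanD ?mean_cst ?meanZ //; last exact: bmeasM.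
(* The closeness constant 100^n is relaxed to 400^n; then 2 + 2 times 72 = 146, and 4^n times 400^n
   = 1600^n. *)
apply: (@le_trans _ _ (2 * (400 ^+ n * (4 ^+ n * d)) +
    2 * (72 * 400 ^+ n * (4 ^+ n * d)))).
  rewrite lerD2r ler_pM2l //; apply: le_trans ((vote_additive_close n).2 _ _ mp sp) _.
  by rewrite ler_wpM2r // E4 ler_peMl ?exprn_ge0 // exprn_ege1 // ler1n.
by rewrite E16; lra.
Qed.

End NearPolynomial.

(** * Polar coordinates, with the angle in turns *)

Section Polar.
Context {R : realType}.
Implicit Types v w : R * R.

Definition polar v : R[i] := complex.Complex (v.1 * cosc v.2) (v.1 * sinc v.2).
Definition pdif v w : R * R := (v.1 * w.1, v.2 - w.2).
Definition clamp (t : R) : R := Num.max 0 (Num.min 1 t).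
(** The real part of [polar v] when the radius lies in [0, 1]. The clamp bounds it on all pairs, as
    the general lemmas on [avg] require. *)
Definition creal v : R := clamp v.1 * cosc v.2.

Lemma clamp_id t : 0 <= t <= 1 -> clamp t = t.
Proof. by move=> /andP[t0 t1]; rewrite /clamp min_r // max_r. Qed.

Lemma clamp_ge0 t : 0 <= clamp t.
Proof. by rewrite /clamp le_max lexx. Qed.

Lemma clamp_le1 t : clamp t <= 1.
Proof. by rewrite /clamp ge_max ler01 ge_min lexx. Qed.

Lemma creal_norm v : `|creal v| <= 1.
Proof.
rewrite /creal normrM ger0_norm ?clamp_ge0 // mulr_ile1 ?clamp_ge0 ?clamp_le1 //.
exact: cos_max.
Qed.

Lemma measurable_creal : measurable_fun setT creal.
Proof.
apply: measurable_funM; last exact: (measurableT_comp measurable_cosc).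
by apply: measurable_maxr => //; apply: measurable_minr.
Qed.

Lemma measurable_pdif : measurable_fun setT (fun z : (R * R) * (R * R) => pdif z.1 z.2).
Proof.
apply: measurable_fun_pair; [apply: measurable_funM|apply: measurable_funB].
- exact: (measurableT_comp measurable_fst measurable_fst).
- exact: (measurableT_comp measurable_fst measurable_snd).
- exact: (measurableT_comp measurable_snd measurable_fst).
- exact: (measurableT_comp measurable_snd measurable_snd).
Qed.

Lemma polarM_conj v w : polar v * conjc (polar w) = polar (pdif v w).
Proof.
rewrite /polar /pdif; apply/eqP; rewrite eq_complex /=; apply/andP; split; apply/eqP.
  by rewrite coscB; ring.
by rewrite sincB; ring.
Qed.

Lemma polar_e_ (t : R) : polar (1, t) = e_ t.
Proof. by rewrite /polar /e_ !mul1r. Qed.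

Definition to_polar (z : R[i]) : R * R :=
  (Num.sqrt (complex.Re z ^+ 2 + complex.Im z ^+ 2), arg (complex.Re z) (complex.Im z)).

Lemma to_polarK z : polar (to_polar z) = z.
Proof.
case: z => a b; rewrite /polar /to_polar /=.
by have [aE bE] := argP a b; rewrite -aE -bE.
Qed.

(** The law of cosines for the squared distance from [polar v] to e(t). *)
Definition sqdist v (t : R) : R := v.1 ^+ 2 + 1 - 2 * v.1 * cosc (v.2 - t).

Lemma normc_sqdist v t :
  ComplexField.Normc.normc (polar v - e_ t) ^+ 2 = sqdist v t.
Proof.
rewrite /polar /e_ /= -/(cosc t) -/(sinc t) sqr_sqrtr ?addr_ge0 ?sqr_ge0 //.
rewrite /sqdist coscB.
have := cosc_sinc_sqr t; have := cosc_sinc_sqr v.2.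
move: (cosc t) (sinc t) (cosc v.2) (sinc v.2) => c s c' s' h1 h2.
transitivity (v.1 ^+ 2 * (c' ^+ 2 + s' ^+ 2) + (c ^+ 2 + s ^+ 2) -
    2 * v.1 * (c' * c + s' * s)); first by ring.
by rewrite h1 h2 mulr1.
Qed.

(** With radius a and cosine c, the squared distance is (1 - a)^2 + 2 a (1 - c), a radial part plus
    a phase part. *)
Lemma sqdist_le v t : 0 <= v.1 <= 1 -> sqdist v t <= (1 - v.1) + 2 * osc (v.2 - t).
Proof.
move=> /andP[a0 a1]; rewrite /sqdist /osc; have := cos_le1 (2 * pi * (v.2 - t)).
rewrite -/(cosc _); move: (cosc _) => c c1; nra.
Qed.

End Polar.

(** * Gowers norms in polar form *)

Section Gowers.
Context {R : realType} {G : topologicalZmodType} (mu : probability (borel G) R).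
Hypothesis H : haar_group mu.
Implicit Types (w : G -> R * R) (p : G -> R).

Definition avgC := avg mu (@pdif R) (@creal R).
Definition wdif (h : G) w : G -> R * R := fun x => pdif (w (x - h)) (w x).

Definition pbounded w := measurable_fun setT (w : borel G -> R * R) /\
  forall x, 0 <= (w x).1 <= 1.

Lemma pbounded_wdif h w : pbounded w -> pbounded (wdif h w).
Proof.
move=> [mw w01]; split.
  exact: (measurableT_comp (@measurable_pdif R)
    (measurable_fun_pair (measurable_transl H h mw) mw)).
move=> x; have /andP[a0 a1] := w01 (x - h); have /andP[b0 b1] := w01 x.
by rewrite /= mulr_ge0 //= mulr_ile1.
Qed.

Lemma measurable_angle w : pbounded w -> measurable_fun setT (fun x : borel G => (w x).2).
Proof. by move=> [mw _]; exact: (measurableT_comp measurable_snd mw). Qed.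

Lemma measurable_radius w : pbounded w -> measurable_fun setT (fun x : borel G => (w x).1).
Proof. by move=> [mw _]; exact: (measurableT_comp measurable_fst mw). Qed.

Lemma bmeas_radius w : pbounded w -> bmeas (fun x : borel G => (w x).1).
Proof.
move=> pw; split; first exact: measurable_radius.
by exists 1 => x; have /andP[? ?] := pw.2 x; rewrite ger0_norm.
Qed.

Lemma bmeas_avgC n w : pbounded w -> bmeas (avgC n w : borel G -> R).
Proof.
move=> [mw _]; exact: (bmeas_avg H (@measurable_pdif R) (@measurable_creal R) (@creal_norm R) mw).
Qed.

Lemma bmeas_avgC_h n w x : pbounded w -> bmeas (fun h : borel G => avgC n (wdif h w) x).
Proof.
move=> [mw _]; exact: (bmeas_avg_h H (@measurable_pdif R) (@measurable_creal R) (@creal_norm R) mw).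
Qed.

Lemma mean_avgCS n w : pbounded w ->
  mean mu (avgC n.+1 w) = mean mu (fun h => mean mu (avgC n (wdif h w))).
Proof.
move=> [mw _]; exact: (mean_avgS H (@measurable_pdif R) (@measurable_creal R) (@creal_norm R) mw).
Qed.

(** Radii multiply under [wdif] and are at most 1. Hence a Gowers norm close to 1 forces the mean
    radius to be close to 1. *)
Lemma avgC_le n w x : pbounded w -> avgC n w x <= (w x).1.
Proof.
elim: n w => [|n IH] w pw.
  rewrite /avgC /= /creal clamp_id ?pw.2 //.
  by have /andP[a0 _] := pw.2 x; rewrite ler_piMr // cos_le1.
rewrite /avgC /=; apply: mean_le_cst => [|h]; first exact: bmeas_avgC_h.
apply: (le_trans (IH _ (pbounded_wdif h pw))) => /=.
have /andP[a0 _] := pw.2 x; have /andP[_ b1] := pw.2 (x - h).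
by rewrite ler_piMl.
Qed.

(* If [0 <= a <= 1] then [1 - c <= 2 (1 - a c)] for every cosine [c]. *)
Lemma avg_osc_le n w x : pbounded w ->
  avgR mu osc n (fun y => (w y).2) x <= 2 * (1 - avgC n w x).
Proof.
elim: n w => [|n IH] w pw.
  rewrite /avgR /avgC /= /creal clamp_id ?pw.2 //.
  have /andP[a0 a1] := pw.2 x; rewrite /osc.
  have := cos_le1 (2 * pi * (w x).2); have := cos_geN1 (2 * pi * (w x).2).
  rewrite -/(cosc _); move: (cosc _) (w x).1 a0 a1 => c a a0 a1 c0 c1.
  by nra.
have b1 := bmeas_cst (T := borel G) (1 : R).
have b2 := bmeas_cst (T := borel G) (2 : R).
have bC := bmeas_avgC_h n x pw.
rewrite /avgR /avgC /= -/(avgC n).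
rewrite -[X in _ * (X - _)](mean_cst mu) -meanB // -meanZ; last exact: bmeasB.
apply: le_mean => [||h].
- exact: (bmeas_avg_osc_h H n x (measurable_angle pw)).
- by apply: bmeasM => //; exact: bmeasB.
exact: (IH _ (pbounded_wdif h pw)).
Qed.

Lemma avgC_unit n w x : (forall y, (w y).1 = 1) ->
  measurable_fun setT (fun x : borel G => (w x).2) ->
  avgC n w x = 1 - avgR mu osc n (fun y => (w y).2) x.
Proof.
elim: n w => [|n IH] w w1 mw.
  by rewrite /avgR /avgC /= /creal w1 clamp_id ?ler01 ?lexx // mul1r /osc subKr.
rewrite /avgR /avgC /= -/(avgC n) -[X in X - _](mean_cst mu) -meanB; last first.
- exact: (bmeas_avg_osc_h H n x mw).
- exact: bmeas_cst.
apply: eq_mean => h; rewrite IH //.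
  by move=> y /=; rewrite !w1 mulr1.
exact: (measurable_dif H h mw).
Qed.

Lemma gowers_rec_ge0 n (f : G -> R[i]) : 0 <= gowers_rec mu n f.
Proof.
case: n => [|n] /=; last exact: powR_ge0.
by rewrite /cintegral /=; exact: sqrtr_ge0.
Qed.

Lemma powR_rootK (x : R) m : 0 <= x -> (0 < m)%N -> (x `^ (m%:R)^-1) ^+ m = x.
Proof.
move=> x0 m0; rewrite -powR_mulrn ?powR_ge0 // -powRrM mulVf ?powRr1 //.
by rewrite pnatr_eq0 -lt0n.
Qed.

Lemma gowers_rec_avg n w : pbounded w ->
  gowers_rec mu n (fun x => polar (w x)) ^+ (2 ^ n.+1) = mean mu (avgC n.+1 w).
Proof.
elim: n w => [|n IH] w pw.
  pose A := mean mu (fun x => (w x).1 * cosc (w x).2).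
  pose S := mean mu (fun x => (w x).1 * sinc (w x).2).
  have bw := bmeas_radius pw; have ma := measurable_angle pw.
  have bA : bmeas (fun x : borel G => (w x).1 * cosc (w x).2).
    by apply: bmeasM => //; exact: bmeas_cosc.
  have bS : bmeas (fun x : borel G => (w x).1 * sinc (w x).2).
    by apply: bmeasM => //; exact: bmeas_sinc.
  have bc c := bmeas_cst (T := borel G) (c : R).
  (* Base case: the squared modulus of the integral of f is the double integral of Re (f(x - h) conj
     f(x)), which separates after the reflection h -> x - h. *)
  rewrite /= /cintegral /= -/A -/S sqr_sqrtr ?addr_ge0 ?sqr_ge0 //.
  rewrite /avgC /= (@eq_mean _ _ _ mu _ (fun x =>
    A * ((w x).1 * cosc (w x).2) + S * ((w x).1 * sinc (w x).2))).
    by rewrite meanD ?meanZ // ; exact: bmeasM.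
  move=> x.
  have refl (u : G -> R) : bmeas (u : borel G -> R) ->
      bmeas (fun h : borel G => u (x - (h : G))).
    move=> bu; apply: (bmeasT_comp bu (g := fun h : borel G => x - (h : G) : borel G)).
    by apply: (measurable_subG H) => //; exact: measurable_cst.
  rewrite (@eq_mean _ _ _ mu _ (fun h =>
    ((w x).1 * cosc (w x).2) * ((w (x - h)).1 * cosc (w (x - h)).2) +
    ((w x).1 * sinc (w x).2) * ((w (x - h)).1 * sinc (w (x - h)).2))).
    have bAr := refl _ bA; have bSr := refl _ bS.
    rewrite meanD; [|exact: (bmeasM (bc _) bAr)|exact: (bmeasM (bc _) bSr)].
    rewrite (meanZ _ _ bAr) (meanZ _ _ bSr).
    by rewrite (mean_subl H x bA) (mean_subl H x bS) -/A -/S; ring.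
  move=> h; rewrite /creal clamp_id; last exact: (pbounded_wdif h pw).2.
  by rewrite /= coscB; ring.
(* The outer power cancels the root in the recursive definition, since the integral under the root
   is nonnegative. *)
rewrite [LHS]/= powR_rootK ?expn_gt0 //; last first.
  apply: fine_ge0; apply: integral_ge0 => h _.
  by rewrite lee_fin exprn_ge0 // gowers_rec_ge0.
rewrite mean_avgCS // /mean /Rintegral; congr fine; apply: eq_integral => h _.
congr EFin; rewrite -[RHS]/(mean mu (avgC n.+1 (wdif h w))) -IH; last exact: pbounded_wdif.
congr (gowers_rec _ _ _ ^+ _); apply/funext => x.
exact: (polarM_conj (w (x - h)) (w x)).
Qed.

Lemma cmeasurable_transl_conj h (f : G -> R[i]) : cmeasurable f ->
  cmeasurable (fun x => transl h f x * conjc (f x)).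
Proof.
move=> [mr mi].
have mrh := measurable_transl H h mr; have mih := measurable_transl H h mi.
have E x : transl h f x * conjc (f x) =
  complex.Complex (complex.Re (f (x - h)) * complex.Re (f x) + complex.Im (f (x - h)) * complex.Im (f x))
   (complex.Im (f (x - h)) * complex.Re (f x) - complex.Re (f (x - h)) * complex.Im (f x)).
  rewrite /transl; case: (f x) (f (x - h)) => [a b] [c e].
  by apply/eqP; rewrite eq_complex /=; apply/andP; split; apply/eqP; ring.
split.
  under eq_fun => x do rewrite E /=.
  by apply: measurable_funD; exact: measurable_funM.
under eq_fun => x do rewrite E /=.
by apply: measurable_funB; exact: measurable_funM.
Qed.

(** Translates of null sets are null, so almost everywhere equality passes to T^h f conj(f) for
    every single h. *)
Lemma gowers_rec_ae n (f g : G -> R[i]) : cmeasurable f -> cmeasurable g ->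
  {ae mu, forall x, f x = g x} -> gowers_rec mu n f = gowers_rec mu n g.
Proof.
elim: n f g => [|n IH] f g mf mg fg; rewrite [LHS]/gowers_rec [RHS]/gowers_rec.
  suff -> : cintegral mu f = cintegral mu g by [].
  rewrite /cintegral; congr complex.Complex.
    by apply: (eq_mean_ae mf.1 mg.1); apply: ae_imp fg => x ->.
  by apply: (eq_mean_ae mf.2 mg.2); apply: ae_imp fg => x ->.
congr (fine _ `^ _); apply: eq_integral => h _.
congr ((_ ^+ _)%:E).
apply: IH; [exact: cmeasurable_transl_conj..|].
apply: ae_imp2 fg (ae_transl H h fg) => x fgx fgxh.
by rewrite /transl fgx fgxh.
Qed.

End Gowers.

(** * Near-extremisers, extremisers and the passage to the L^1 distance *)

Section Main.
Context {R : realType} {G : topologicalZmodType} (mu : probability (borel G) R).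
Hypothesis H : haar_group mu.

Lemma bernoulli_ge m (x e : R) : 0 <= x -> 0 <= e -> 1 - e <= x ->
  1 - m%:R * e <= x ^+ m.
Proof.
move=> x0 e0 xe; elim: m => [|m IH]; first by rewrite mul0r subr0.
(* No upper bound on [e] is assumed: if m e > 1 the lower bound to prove is negative. *)
have [me1|me1] := leP (m%:R * e) 1; last first.
  apply: (@le_trans _ _ 0); last by rewrite exprn_ge0.
  by rewrite -natr1; lra.
rewrite exprS -natr1.
have : (1 - e) * (1 - m%:R * e) <= x * x ^+ m.
  apply: (@le_trans _ _ (x * (1 - m%:R * e))); last by rewrite ler_wpM2l.
  by rewrite ler_wpM2r // subr_ge0.
have : 0 <= m%:R * e * e by rewrite !mulr_ge0.
lra.
Qed.

Lemma ae_n_all m (Q : seq G -> Prop) : (forall s, size s = m -> Q s) -> ae_n mu m Q.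
Proof.
elim: m Q => [|m IH] Q hQ /=; first exact: hQ.
by apply: aeW => h; apply: IH => s ss; apply: hQ; rewrite /= ss.
Qed.

Lemma polynomial_le_exact n (P : G -> R) : measurable_fun setT (P : borel G -> R) ->
  (forall hs, size hs = n.+1 -> forall x, exists z : int, diff_iter hs P x = z%:~R) ->
  polynomial_le mu n P.
Proof. by move=> mP hP; split => //; apply: aeW => x; apply: ae_n_all => s /hP. Qed.

Lemma cmeasurable_polar (w : G -> R * R) : pbounded w -> cmeasurable (fun x => polar (w x)).
Proof.
move=> pw; have mr := measurable_radius pw; have ma := measurable_angle pw.
split; apply: measurable_funM => //.
  exact: (measurableT_comp measurable_cosc).
exact: (measurableT_comp measurable_sinc).
Qed.

(** Clamping the radius gives bounds valid at every point and alters f only on the null set where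
    its modulus exceeds 1. *)
Lemma polar_ae (f : G -> R[i]) : cmeasurable f -> Linf_le1 mu f ->
  exists2 w, pbounded w & {ae mu, forall x, f x = polar (w x)}.
Proof.
move=> [mr mi] f1; exists (fun x => (clamp (to_polar (f x)).1, (to_polar (f x)).2)).
  split; last by move=> x; rewrite clamp_ge0 clamp_le1.
  apply: measurable_fun_pair; last exact: measurable_arg.
  apply: measurable_maxr => //; apply: measurable_minr => //.
  apply: (measurableT_comp (f := @Num.sqrt R)).
    by apply: continuous_measurable_fun; exact: sqrt_continuous.
  by apply: measurable_funD; exact: measurable_funX.
apply: ae_imp f1 => x fx; rewrite clamp_id -?surjective_pairing ?to_polarK //.
by rewrite /= sqrtr_ge0; case: (f x) fx.
Qed.

Lemma bmeas_sqdist (w : G -> R * R) (P : G -> R) : pbounded w ->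
  measurable_fun setT (P : borel G -> R) ->
  bmeas (fun x : borel G => sqdist (w x) (P x)).
Proof.
move=> pw mP; have bw := bmeas_radius pw; have ma := measurable_angle pw.
have bc c := bmeas_cst (T := borel G) (c : R).
apply: bmeasB; first by apply: bmeasD => //; exact: bmeasM.
by apply: bmeasM; [exact: bmeasM|apply: bmeas_cosc; exact: measurable_funB].
Qed.

(** From [sqdist_le]: the radial part contributes 2^(n+1), the phase part 2 times 146 times
    1600^(n+1) times a defect of 2 times 2^(n+1), and 584 = 4 times 146. *)
Definition extremal_const n : R := 2 ^+ n.+1 * (1 + 584 * 1600 ^+ n.+1).

Lemma extremal_const_ge0 n : 0 <= extremal_const n.
Proof.
apply: mulr_ge0; first exact: exprn_ge0.
apply: addr_ge0; [exact: ler01|apply: mulr_ge0; first exact: ler0n].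
by apply: exprn_ge0; exact: ler0n.
Qed.

Lemma near_extremiser n (f : G -> R[i]) (e : R) : cmeasurable f -> Linf_le1 mu f ->
  0 <= e -> 1 - e <= gowers_rec mu n f ->
  exists w P, [/\ pbounded w, {ae mu, forall x, f x = polar (w x)},
    measurable_fun setT (P : borel G -> R), polynomial_le mu n P &
    mean mu (fun x => sqdist (w x) (P x)) <= extremal_const n * e].
Proof.
move=> mf f1 e0 hf; have [w pw fw] := polar_ae mf f1.
have ma := measurable_angle pw; have bw := bmeas_radius pw.
have bC := bmeas_avgC H n.+1 pw.
have bc c := bmeas_cst (T := borel G) (c : R).
(* Bernoulli's inequality passes from the norm to its 2^(n+1)-th power. *)
have hW : 1 - 2 ^+ n.+1 * e <= mean mu (avgC mu n.+1 w).
  rewrite -(gowers_rec_avg H n pw) -natrX; apply: bernoulli_ge => //.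
    exact: gowers_rec_ge0.
  by rewrite -(gowers_rec_ae H n mf (cmeasurable_polar pw) fw).
have hd : defect mu n.+1 (fun x => (w x).2) <= 2 * (2 ^+ n.+1 * e).
  apply: (@le_trans _ _ (mean mu (fun x => 2 * (1 - avgC mu n.+1 w x)))).
    apply: le_mean => [||x]; last exact: avg_osc_le.
      exact: (bmeas_osc_avg H n.+1 ma).
    by apply: bmeasM => //; exact: bmeasB.
  rewrite meanZ; last exact: bmeasB.
  by rewrite meanB // mean_cst; move: hW; lra.
have [P [mP iP cP]] := near_polynomial H ma hd.
exists w, P; split => //; first exact: polynomial_le_exact.
have bo : bmeas (fun x : borel G => osc ((w x).2 - P x)).
  by apply: bmeas_osc; exact: measurable_funB.
apply: (@le_trans _ _ (mean mu (fun x => (1 - (w x).1) + 2 * osc ((w x).2 - P x)))).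
  apply: le_mean => [||x]; first exact: bmeas_sqdist.
    by apply: bmeasD; [exact: bmeasB|exact: bmeasM].
  by apply: sqdist_le; exact: pw.2.
rewrite meanD ?meanB ?mean_cst ?meanZ //; [|exact: bmeasB|exact: bmeasM].
have hr : mean mu (avgC mu n.+1 w) <= mean mu (fun x => (w x).1).
  by apply: le_mean => // x; exact: avgC_le.
rewrite /extremal_const; move: hW hr cP.
move: (mean mu (avgC _ _ _)) (mean mu (fun x => (w x).1)) (mean mu (fun x => osc _)).
by move=> A B C; lra.
Qed.

Lemma eq_e_of_sqdist (v : R * R) (t : R) : sqdist v t = 0 -> polar v = e_ t.
Proof.
rewrite -normc_sqdist => /eqP; rewrite sqrf_eq0 => /eqP.
by move/ComplexField.Normc.eq0_normc/eqP; rewrite subr_eq0 => /eqP.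
Qed.

(** [ae_n] and [avg] both take the shifts one at a time from the outside, so the nested null sets
    are handled by the same induction. *)
Lemma avg_osc_polynomial n (P : G -> R) x : measurable_fun setT (P : borel G -> R) ->
  ae_n mu n (fun hs => exists z : int, diff_iter hs P x = z%:~R) ->
  avgR mu osc n P x = 0.
Proof.
elim: n P => [|n IH] P mP /=; first by move=> [z Pz]; rewrite /avgR /= Pz osc_int.
move=> hP; rewrite /avgR /= -/(avgR mu osc n).
apply: mean_eq0_ae.
- by case: (bmeas_avg_osc_h H n x mP).
- by move=> h; exact: avg_osc_ge0.
apply: ae_imp hP => h hP; apply: IH; first exact: (measurable_dif H).
rewrite (_ : (fun s => _) = (fun s => exists z : int, diff_iter (h :: s) P x = z%:~R)) //.
by apply/funext => s; rewrite diff_iter_dif.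
Qed.

Lemma gowers_polynomial n (f : G -> R[i]) (P : G -> R) : cmeasurable f ->
  polynomial_le mu n P -> {ae mu, forall x, f x = e_ (P x)} -> gowers_rec mu n f = 1.
Proof.
move=> mf [mP hP] fP; pose w x : R * R := (1, P x).
have pw : pbounded w.
  by split; [exact: measurable_fun_pair|move=> x; rewrite /= ler01 lexx].
have fw : {ae mu, forall x, f x = polar (w x)}.
  by apply: ae_imp fP => x ->; rewrite polar_e_.
rewrite (gowers_rec_ae H n mf (cmeasurable_polar pw) fw).
have : gowers_rec mu n (fun x => polar (w x)) ^+ (2 ^ n.+1) = 1.
  rewrite (gowers_rec_avg H n pw).
  have bo := bmeas_osc_avg H n.+1 mP.
  rewrite (@eq_mean _ _ _ mu _ (fun x => 1 - avgR mu osc n.+1 P x)); last first.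
    by move=> x; exact: avgC_unit.
  rewrite meanB ?mean_cst //; last exact: bmeas_cst.
  rewrite [X in _ - X](_ : _ = 0) ?subr0 //.
  rewrite (eq_mean_ae (v := cst 0)) ?mean_cst //; first by case: bo.
  by apply: ae_imp hP => x; exact: avg_osc_polynomial.
have g0 := gowers_rec_ge0 mu n (fun x => polar (w x)).
by move/eqP; rewrite pexprn_eq1 ?expn_gt0 // expn_eq0 => /eqP.
Qed.

(** The L^1 norm is bounded through the L^2 norm by integrating y <= r / 2 + y^2 / (2 r), valid for
    every r > 0. *)
Lemma integral_normc_ae (f : G -> R[i]) (w : G -> R * R) (P : G -> R) (e : R) :
  cmeasurable f -> pbounded w -> measurable_fun setT (P : borel G -> R) ->
  {ae mu, forall x, f x = polar (w x)} -> 0 <= e ->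
  mean mu (fun x => sqdist (w x) (P x)) <= e ^+ 2 ->
  (\int[mu]_x (ComplexField.Normc.normc (f x - e_ (P x)))%:E <= e%:E)%E.
Proof.
move=> [mr mi] pw mP fw e0 hsq.
have bs := bmeas_sqdist pw mP.
have bc c := bmeas_cst (T := borel G) (c : R).
pose g x := Num.sqrt (sqdist (w x) (P x)).
have gE x : ComplexField.Normc.normc (polar (w x) - e_ (P x)) = g x.
  rewrite /g -normc_sqdist sqrtr_sqr ger0_norm //.
  by case: (_ - _) => a b; exact: sqrtr_ge0.
have sq0 x : 0 <= sqdist (w x) (P x) by rewrite -normc_sqdist sqr_ge0.
have msqrt : measurable_fun setT (@Num.sqrt R).
  by apply: continuous_measurable_fun; exact: sqrt_continuous.
have bg : bmeas (g : borel G -> R).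
  split; first by case: bs => ms _; exact: (measurableT_comp msqrt).
  have [M hM] := bs.2; exists (Num.sqrt M) => x.
  by rewrite ger0_norm ?sqrtr_ge0 // ler_wsqrtr // (le_trans (ler_norm _)).
have -> : (\int[mu]_x (ComplexField.Normc.normc (f x - e_ (P x)))%:E =
    \int[mu]_x (g x)%:E)%E.
  apply: ae_eq_integral => //.
  - apply/measurable_EFinP.
    have -> : (fun x => ComplexField.Normc.normc (f x - e_ (P x))) = (fun x =>
        Num.sqrt ((complex.Re (f x) - cosc (P x)) ^+ 2 +
                  (complex.Im (f x) - sinc (P x)) ^+ 2)).
      by apply/funext => x; case: (f x).
    apply: (measurableT_comp msqrt); apply: measurable_funD; apply: measurable_funX.
      by apply: measurable_funB => //; exact: (measurableT_comp measurable_cosc).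
    by apply: measurable_funB => //; exact: (measurableT_comp measurable_sinc).
  - by apply/measurable_EFinP; case: bg.
  by apply: ae_imp fw => x -> _; rewrite gE.
rewrite -(EFin_mean mu bg) lee_fin.
have bound r : 0 < r -> e <= r -> mean mu g <= r.
  move=> r0 er.
  apply: (@le_trans _ _ (mean mu (fun x => r / 2 + (2 * r)^-1 * sqdist (w x) (P x)))).
    apply: le_mean => [||x] //; first by apply: bmeasD => //; exact: bmeasM.
    rewrite /g; have := sqr_sqrtr (sq0 x); move: (Num.sqrt _) => y <-.
    have -> : r / 2 + (2 * r)^-1 * y ^+ 2 = y + (r - y) ^+ 2 * (2 * r)^-1.
      by field; rewrite gt_eqF.
    by rewrite lerDl mulr_ge0 ?sqr_ge0 // invr_ge0 mulr_ge0 // ltW.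
  rewrite meanD ?mean_cst ?meanZ //; last exact: bmeasM.
  have rE : r / 2 + (2 * r)^-1 * r ^+ 2 = r by field; rewrite gt_eqF.
  rewrite -[X in _ <= X]rE lerD2l ler_wpM2l //; first by rewrite invr_ge0 mulr_ge0 // ltW.
  by apply: (le_trans hsq); rewrite lerXn2r ?nnegrE // ltW.
(* [e] may be 0, so the bound is taken at r = e + s for each s > 0. *)
apply/ler_addgt0Pr => s s0; apply: bound; first by rewrite ltr_wpDl.
by rewrite lerDl ltW.
Qed.

Lemma cvg_sqrt_const (K : R) : Num.sqrt (K * x) @[x --> 0^'+] --> (0 : R).
Proof.
apply: cvg_at_right_filter.
have : (fun x : R => Num.sqrt (K * x)) x @[x --> 0] --> Num.sqrt (K * 0).
  apply: continuous_comp; first exact: mulrl_continuous.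
  exact: sqrt_continuous.
by rewrite mulr0 sqrtr0.
Qed.

End Main.

Theorem theorem1p10 (R : realType) (k : nat) (hk : (1 <= k)%N) :
  (* (1) extremisers *)
  (forall (G : topologicalZmodType) (mu : probability (borel G) R),
     compact_abelian_group (G := G) -> normalised_haar mu ->
     forall f : G -> R[i], cmeasurable f -> Linf_le1 mu f ->
       (gowers_norm mu k f = 1 <->
        exists P : G -> R, polynomial_le mu k.-1 P /\
          {ae mu, forall x, f x = e_ (P x)}))
  /\
  (* (2) near-extremisers *)
  (exists c : R -> R,
     (forall eps, 0 <= eps -> 0 <= c eps) /\
     (c x @[x --> 0^'+] --> 0) /\
     forall (G : topologicalZmodType) (mu : probability (borel G) R),
       compact_abelian_group (G := G) -> normalised_haar mu ->
       forall f : G -> R[i], cmeasurable f -> Linf_le1 mu f ->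
       forall eps : R, 0 <= eps -> gowers_norm mu k f >= 1 - eps ->
         exists P : G -> R, polynomial_le mu k.-1 P /\
           (\int[mu]_x (complex.ComplexField.Normc.normc (f x - e_ (P x)))%:E <= (c eps)%:E)%E).
Proof.
(* With k = n + 1, [gowers_rec] at n is the U^k norm, and degree at most n means that n + 1
   differences vanish. *)
case: k hk => // n _; rewrite /gowers_norm /=; split.
  move=> G mu [_ _ scG] hmu f mf f1; have H : haar_group mu by [].
  split=> [g1|[P [hP fP]]]; last exact: gowers_polynomial hP fP.
  (* Extremisers are the near-extremisers with defect 0, for which the mean squared distance to e(P)
     vanishes. *)
  have g1' : 1 - 0 <= gowers_rec mu n f by rewrite g1 subr0.
  have [w [P [pw fw mP hP]]] := near_extremiser H mf f1 (lexx 0) g1'.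
  rewrite mulr0 => sq; exists P; split => //.
  have bs := bmeas_sqdist pw mP.
  have s0 x : 0 <= sqdist (w x) (P x) by rewrite -normc_sqdist sqr_ge0.
  have m0 : mean mu (fun x => sqdist (w x) (P x)) = 0.
    by apply/eqP; rewrite eq_le sq; exact: mean_ge0.
  apply: ae_imp2 fw (ae_of_mean_eq0 bs s0 m0) => x -> h.
  exact: eq_e_of_sqdist.
(* The squared L^2 distance is linear in the defect, so the L^1 distance is at most its square
   root. *)
exists (fun x : R => Num.sqrt (extremal_const n * x)); split; [|split].
- by move=> e _; exact: sqrtr_ge0.
- exact: cvg_sqrt_const.
move=> G mu [_ _ scG] hmu f mf f1 e e0 hf; have H : haar_group mu by [].
have [w [P [pw fw mP hP sq]]] := near_extremiser H mf f1 e0 hf.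
exists P; split => //; apply: (integral_normc_ae mf pw mP fw (sqrtr_ge0 _)).
rewrite sqr_sqrtr; first exact: sq.
exact: mulr_ge0 (extremal_const_ge0 n) e0.
Qed.
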